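(* For every real number $k>1$ there exists $\varepsilon\in(0,\tfrac12)$ with $k(1-2\varepsilon)^2>1$ (so that partial recovery in the broadcast tree model with these parameters is possible), and yet there is a monotone cutting adversary for which partial recovery in the cutting semirandom broadcast tree model is information-theoretically impossible: no estimator of the root spin, as a function of the observed tree and the spins of its leaves, achieves partial recovery.
   Context: Broadcast tree model with parameters $k>0$, $\varepsilon\in[0,\frac12)$ and depth $R$ (equivalently $a=2k(1-\varepsilon)$, $b=2k\varepsilon$): the root $\rho$ (level 0) gets a uniformly random spin $\sigma_\rho\in\{\pm1\}$; each node gives birth independently to $\mathrm{Pois}(a/2)$ children of its own spin and $\mathrm{Pois}(b/2)$ children of the opposite spin, until level $R$; nodes at level $R$ are the leaves. Cutting semirandom model: sample such a precursor tree; an adversary (seeing the whole labeled tree) may delete any edges joining a node to a child of opposite spin, thereby removing the corresponding subtrees; the resulting tree (topology) together with the spins of its remaining leaves is observed, the removed subtrees are not revealed. An estimator $\hat\sigma_\rho$ achieves partial recovery if there exists $\eta>\frac12$ such that $\Pr[\hat\sigma_\rho=\sigma_\rho]\ge\eta$ as $R\to\infty$. (It is known that partial recovery in the random broadcast tree model is possible when $k(1-2\varepsilon)^2>1$.) *)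

(* Defs.v *)
From HB Require Import structures.
From mathcomp Require Import all_boot all_order all_algebra.
From mathcomp Require Import all_classical all_reals all_analysis.

Set Implicit Arguments.
Unset Strict Implicit.
Unset Printing Implicit Defensive.
Import Order.TTheory GRing.Theory Num.Theory.
Local Open Scope classical_set_scope.
Local Open Scope ring_scope.

Inductive tree (L : Type) : Type := Node of L & seq (tree L).

Section TreeChoice.
Variable L : Type.

Fixpoint tree_encode (t : tree L) : GenTree.tree L :=
  let: Node x cs := t in
  GenTree.Node 0 (GenTree.Leaf x :: map tree_encode cs).

Fixpoint tree_decode (g : GenTree.tree L) : option (tree L) :=
  if g is GenTree.Node _ (GenTree.Leaf x :: gs)
  then Some (Node x (pmap tree_decode gs)) else None.

Fixpoint tree_encodeK (t : tree L) : tree_decode (tree_encode t) = Some t.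
Proof.
case: t => x cs /=; congr (Some (Node x _)).
by elim: cs => //= c cs IHcs; rewrite tree_encodeK /= IHcs.
Qed.

End TreeChoice.

HB.instance Definition _ (L : eqType) :=
  Equality.copy (tree L) (pcan_type (@tree_encodeK L)).
HB.instance Definition _ (L : choiceType) :=
  Choice.copy (tree L) (pcan_type (@tree_encodeK L)).

Definition root_label (L : Type) (t : tree L) : L := let: Node x _ := t in x.

(* Isomorphism of rooted labelled trees, children being unordered. *)
Inductive tree_iso (L : Type) : tree L -> tree L -> Prop :=
| TreeIso x cs cs' : forest_iso cs cs' -> tree_iso (Node x cs) (Node x cs')
with forest_iso (L : Type) : seq (tree L) -> seq (tree L) -> Prop :=
| ForestIsoNil : forest_iso [::] [::]
| ForestIsoCons c c' cs cs1 cs2 :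
    tree_iso c c' -> forest_iso cs (cs1 ++ cs2) ->
    forest_iso (c :: cs) (cs1 ++ c' :: cs2).

(* Spins are booleans: true is +1, false is -1. *)

Section BroadcastTree.
Variable R : realType.

(* Probability mass function of the depth-d broadcast tree given the root spin
   s.  A node's own-spin children are listed before its opposite-spin ones;
   estimators, being invariant under tree_iso, cannot exploit this order. *)
Fixpoint broadcast_pmf (a b : R) (d : nat) (s : bool) (t : tree bool) : R :=
  if d is d'.+1 then
    let: Node x cs := t in
    let own := [seq c <- cs | root_label c == s] in
    let opp := [seq c <- cs | root_label c == ~~ s] in
    if (x == s) && (cs == own ++ opp) then
      (poisson_pmf (a / 2) (size own) *
         \prod_(c <- own) broadcast_pmf a b d' s c) *
      (poisson_pmf (b / 2) (size opp) *
         \prod_(c <- opp) broadcast_pmf a b d' (~~ s) c)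
    else 0
  else (t == Node s [::])%:R.

Definition broadcast_prob (a b : R) (d : nat) (A : set (tree bool)) : \bar R :=
  \esum_(t in A) (2^-1 * broadcast_pmf a b d (root_label t) t)%:E.

End BroadcastTree.

(* cut_tree t t': t' is obtained from t by deleting some edges between a node
   and a child of opposite spin, with the subtrees hanging from them. *)
Inductive cut_tree : tree bool -> tree bool -> Prop :=
| CutTree s cs cs' : cut_children s cs cs' -> cut_tree (Node s cs) (Node s cs')
with cut_children : bool -> seq (tree bool) -> seq (tree bool) -> Prop :=
| CutNil s : cut_children s [::] [::]
| CutDelete s c cs cs' :
    root_label c = ~~ s -> cut_children s cs cs' ->
    cut_children s (c :: cs) cs'
| CutKeep s c c' cs cs' :
    cut_tree c c' -> cut_children s cs cs' ->
    cut_children s (c :: cs) (c' :: cs').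

(* The first argument of adversaries and estimators is the depth. *)
Definition cutting_adversary (adv : nat -> tree bool -> tree bool) : Prop :=
  forall d t, cut_tree t (adv d t).

(* Only the nodes at level d, the leaves, keep their spin. *)
Fixpoint observe (d : nat) (t : tree bool) : tree (option bool) :=
  let: Node s cs := t in
  if d is d'.+1 then Node None [seq observe d' c | c <- cs]
  else Node (Some s) [::].

Definition root_estimator (est : nat -> tree (option bool) -> bool) : Prop :=
  forall d o o', tree_iso o o' -> est d o = est d o'.

Definition partial_recovery (R : realType) (a b : R)
    (adv : nat -> tree bool -> tree bool)
    (est : nat -> tree (option bool) -> bool) : Prop :=
  exists2 eta : R, 2^-1 < eta &
    \forall d \near \oo,
      (eta%:E <= broadcast_prob a b d
        [set t | est d (observe d (adv d t)) = root_label t])%E.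

(* Main.v *)
Require Import Defs.
From mathcomp Require Import all_boot all_order all_algebra.
From mathcomp Require Import all_classical all_reals all_analysis.
From mathcomp Require Import ring lra.
Import Order.TTheory GRing.Theory Num.Theory.
Import numFieldNormedType.Exports.
Set Implicit Arguments.
Unset Strict Implicit.
Unset Printing Implicit Defensive.
Local Open Scope classical_set_scope.
Local Open Scope ring_scope.

(** On a path u - v - w whose middle vertex has no other child, deleting the
    configurations where v differs from both u and w weakens the correlation
    between u and w, since these are configurations with w = u.  Deleting all of
    them would overshoot and make the correlation negative for small
    1 - 2 eps, so the deletion is made conditional on an event independent of
    everything observed: the adversary erases every childless child of v of
    spin opposite to v, and cuts v off only if it erased at least one.

    The adversary works on blocks of two levels.  The observed children of a
    vertex form a Poisson process whose intensity depends on its spin, and the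
    squared Hellinger distance of two Poisson processes is at most that of
    their intensities.  An edge contracts the squared Hellinger distance of the
    laws below the two spins by (1 - 2 eps)^2, a thinned path by strictly
    more than (1 - 2 eps)^4.  Hence one block multiplies it by a factor that is
    below 1 at k (1 - 2 eps)^2 = 1 and, by continuity, for slightly smaller
    eps.  The laws of the observation under the two root spins thus merge as
    the depth grows. *)

(** * Sums over Poisson point processes *)

Section WeightedSums.
Context {R : realType}.
Local Open Scope ereal_scope.

Lemma esumZ (T : choiceType) (D : set T) (c : R) (f : T -> \bar R) :
  (0 <= c)%R -> (forall x, 0 <= f x) ->
  \esum_(x in D) (c%:E * f x) = c%:E * \esum_(x in D) f x.
Proof.
move=> c0 f0; rewrite /esum -ereal_supZl//; last first.
  by apply/set0P; exists 0, set0; [exact: fsets_set0|rewrite fsbig_set0].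
congr ereal_sup; apply/seteqP; split => [_ [X FX <-]|_ [_ [X FX <-] <-]] /=.
  exists (\sum_(x \in X) f x); first by exists X.
  by rewrite ge0_mule_fsumr.
by exists X => //; rewrite ge0_mule_fsumr.
Qed.

Lemma esum_pair (S T : choiceType) (f : S -> T -> \bar R) :
  (forall x y, 0 <= f x y) ->
  \esum_(x in [set: S]) \esum_(y in [set: T]) f x y =
  \esum_(p in [set: S * T]) f p.1 p.2.
Proof.
move=> f0; rewrite esum_esum//; congr esum.
by apply/seteqP; split.
Qed.

Lemma esum_swap (S T : choiceType) (f : S -> T -> \bar R) :
  (forall x y, 0 <= f x y) ->
  \esum_(x in [set: S]) \esum_(y in [set: T]) f x y =
  \esum_(y in [set: T]) \esum_(x in [set: S]) f x y.
Proof.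
move=> f0; rewrite !esum_pair//.
rewrite (@reindex_esum _ _ _ [set: T * S] [set: S * T] (fun p => (p.2, p.1)))//.
split=> //; first by move=> [a b] [c e] _ _ /= [-> ->].
by move=> [a b] _; exists (b, a).
Qed.

Lemma esum_bool (f : bool -> \bar R) : (forall x, 0 <= f x) ->
  \esum_(x in [set: bool]) f x = f true + f false.
Proof.
move=> f0; rewrite (esumID [set true])//; congr (_ + _).
  by rewrite setTI esum_set1.
rewrite setTI (_ : ~` [set true] = [set false]) ?esum_set1//.
by apply/seteqP; split => -[] //= /(_ erefl).
Qed.

Lemma esum_single (T : choiceType) (t : T) (f : T -> \bar R) : 0 <= f t ->
  (forall x, x != t -> f x = 0) -> \esum_(x in [set: T]) f x = f t.
Proof.
move=> f0 fn; rewrite -[RHS](@esum_set1 _ _ t f)// [RHS]esum_mkcond.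
apply: eq_esum => x _; have [->|xt] := eqVneq x t; first by rewrite mem_set.
by rewrite memNset ?fn// => /= e; rewrite e eqxx in xt.
Qed.

Lemma esum_tree (L : choiceType) (f : tree L -> \bar R) :
  (forall t, 0 <= f t) ->
  \esum_(t in [set: tree L]) f t =
  \esum_(x in [set: L]) \esum_(cs in [set: seq (tree L)]) f (Node x cs).
Proof.
move=> f0; rewrite esum_pair//.
rewrite (@reindex_esum _ _ _ [set: L * seq (tree L)] [set: tree L]
  (fun p => Node p.1 p.2))//.
split=> //; first by move=> [a b] [c e] _ _ /= [-> ->].
by move=> [a b] _; exists (a, b).
Qed.

(** Iterated form of a sum over the lists of length [n]; it lets the points be treated one at a
    time. *)
Fixpoint esum_seqn (T : choiceType) n (F : seq T -> \bar R) : \bar R :=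
  if n is n'.+1 then \esum_(x in [set: T]) esum_seqn n' (fun l => F (x :: l))
  else F [::].

Lemma esum_seqnE (T : choiceType) n (F : seq T -> \bar R) :
  (forall l, 0 <= F l) ->
  \esum_(l in [set l | size l = n]) F l = esum_seqn n F.
Proof.
elim: n F => [|n IH] F F0 /=.
  rewrite (_ : [set l | _] = [set [::]]) ?esum_set1//.
  by apply/seteqP; split => l /=; [move/size0nil|move=> ->].
under [RHS]eq_esum do rewrite -IH//.
rewrite esum_esum//.
rewrite (@reindex_esum _ _ _ ([set: T] `*`` (fun=> [set l | size l = n]))
  [set l | size l = n.+1] (fun p => p.1 :: p.2))//.
split=> //.
- by move=> [a b] [_ /= ->].
- by move=> [a b] [c e] _ _ /= [-> ->].
- by move=> [//|a b] /= [sb]; exists (a, b).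
Qed.

Lemma esum_seq (T : choiceType) (F : seq T -> \bar R) :
  (forall l, 0 <= F l) ->
  \esum_(l in [set: seq T]) F l = \esum_(n in [set: nat]) esum_seqn n F.
Proof.
move=> F0; under [RHS]eq_esum do rewrite -esum_seqnE//.
rewrite -esum_bigcupT//.
  congr esum; apply/seteqP; split => // l _; by exists (size l).
by move=> i j _ _ [l [/= <- <-]].
Qed.

Definition wsum (T : choiceType) (w : T -> R) (F : T -> \bar R) : \bar R :=
  \esum_(x in [set: T]) ((w x)%:E * F x).

Fixpoint wsumn (T : choiceType) (w : T -> R) n (F : seq T -> \bar R) : \bar R :=
  if n is n'.+1 then wsum w (fun x => wsumn w n' (fun l => F (x :: l)))
  else F [::].

(* Up to the factor [expR (- mass w)], the expectation of [F] over a Poisson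
   point process of intensity [w], its points being listed in random order. *)
Definition poisum (T : choiceType) (w : T -> R) (F : seq T -> \bar R) : \bar R :=
  \esum_(n in [set: nat]) ((n`!%:R^-1)%:E * wsumn w n F).

(** The density of [poisum w] on lists, as [poisumE] shows. *)
Definition pweight (T : choiceType) (w : T -> R) (l : seq T) : R :=
  ((size l)`!%:R^-1 * \prod_(x <- l) w x)%R.

Section wsum_theory.
Variables (T : choiceType) (w : T -> R).
Hypothesis w0 : forall x, (0 <= w x)%R.

Lemma wsum_ge0 (F : T -> \bar R) : (forall x, 0 <= F x) -> 0 <= wsum w F.
Proof. by move=> F0; apply: esum_ge0 => x _; rewrite mule_ge0// lee_fin. Qed.

Lemma eq_wsum (F G : T -> \bar R) : F =1 G -> wsum w F = wsum w G.
Proof. by move=> FG; apply: eq_esum => x _; rewrite FG. Qed.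

Lemma wsumD (F G : T -> \bar R) : (forall x, 0 <= F x) -> (forall x, 0 <= G x) ->
  wsum w (fun x => F x + G x) = wsum w F + wsum w G.
Proof.
move=> F0 G0; rewrite /wsum -esumD//; last 2 first.
  by move=> x _; rewrite mule_ge0// lee_fin.
  by move=> x _; rewrite mule_ge0// lee_fin.
by apply: eq_esum => x _; rewrite ge0_muleDr.
Qed.

Lemma wsumZ c (F : T -> \bar R) : (0 <= c)%R -> (forall x, 0 <= F x) ->
  wsum w (fun x => c%:E * F x) = c%:E * wsum w F.
Proof.
move=> c0 F0; rewrite /wsum -esumZ//; last first.
  by move=> x; rewrite mule_ge0// lee_fin.
by apply: eq_esum => x _; rewrite muleCA.
Qed.

Lemma wsum_esum (S : choiceType) (F : T -> S -> \bar R) :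
  (forall x y, 0 <= F x y) ->
  wsum w (fun x => \esum_(y in [set: S]) F x y) =
  \esum_(y in [set: S]) wsum w (F ^~ y).
Proof.
move=> F0; rewrite /wsum -esum_swap//; last first.
  by move=> x y; rewrite mule_ge0// lee_fin.
by apply: eq_esum => x _; rewrite esumZ.
Qed.

Lemma wsumn_ge0 n (F : seq T -> \bar R) : (forall x, 0 <= F x) -> 0 <= wsumn w n F.
Proof. by elim: n F => //= n IH F F0; apply: wsum_ge0 => x; apply: IH. Qed.

Lemma eq_wsumn n (F G : seq T -> \bar R) :
  (forall l, size l = n -> F l = G l) -> wsumn w n F = wsumn w n G.
Proof.
elim: n F G => [|n IH] F G FG /=; first exact: FG.
by apply: eq_wsum => x; apply: IH => l sl; apply: FG; rewrite /= sl.
Qed.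

Lemma wsumnZ n c (F : seq T -> \bar R) : (0 <= c)%R -> (forall x, 0 <= F x) ->
  wsumn w n (fun x => c%:E * F x) = c%:E * wsumn w n F.
Proof.
move=> c0; elim: n F => //= n IH F F0.
under eq_wsum do rewrite IH//.
by rewrite wsumZ// => x; exact: wsumn_ge0.
Qed.

Lemma wsumn_esum n (S : choiceType) (F : seq T -> S -> \bar R) :
  (forall x y, 0 <= F x y) ->
  wsumn w n (fun x => \esum_(y in [set: S]) F x y) =
  \esum_(y in [set: S]) wsumn w n (F ^~ y).
Proof.
elim: n F => //= n IH F F0.
under eq_wsum do rewrite IH//.
by rewrite wsum_esum// => x y; exact: wsumn_ge0.
Qed.

Lemma wsumnE n (F : seq T -> \bar R) : (forall x, 0 <= F x) ->
  wsumn w n F = esum_seqn n (fun l => (\prod_(x <- l) w x)%:E * F l).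
Proof.
elim: n F => [|n IH] F F0 /=; first by rewrite big_nil mul1e.
rewrite /wsum; apply: eq_esum => x _.
rewrite -wsumnZ//.
transitivity (wsumn w n (fun l => (w x)%:E * F (x :: l))); first by [].
rewrite IH; last by move=> l; rewrite mule_ge0// lee_fin.
by congr esum_seqn; apply/funext => l; rewrite muleA -EFinM big_cons (mulrC (w x)).
Qed.

Lemma poisum_ge0 (F : seq T -> \bar R) : (forall x, 0 <= F x) -> 0 <= poisum w F.
Proof.
move=> F0; apply: esum_ge0 => n _.
by rewrite mule_ge0 ?wsumn_ge0// lee_fin invr_ge0.
Qed.

Lemma pweight_ge0 l : (0 <= pweight w l)%R.
Proof. by rewrite /pweight mulr_ge0 ?invr_ge0// prodr_ge0. Qed.

Lemma poisumE (F : seq T -> \bar R) : (forall x, 0 <= F x) ->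
  poisum w F = \esum_(l in [set: seq T]) ((pweight w l)%:E * F l).
Proof.
move=> F0; rewrite esum_seq; last first.
  by move=> l; rewrite mule_ge0 ?lee_fin ?pweight_ge0.
apply: eq_esum => n _.
rewrite -wsumnZ ?invr_ge0// wsumnE; last first.
  by move=> l; rewrite mule_ge0// lee_fin invr_ge0.
rewrite -!esum_seqnE; last 2 first.
  by move=> l; rewrite mule_ge0 ?lee_fin ?pweight_ge0.
  by move=> l; rewrite !mule_ge0 ?lee_fin ?prodr_ge0 ?invr_ge0.
apply: eq_esum => l /= <-.
by rewrite /pweight muleA -EFinM mulrC.
Qed.

End wsum_theory.
End WeightedSums.

(** * Superposition of Poisson processes *)

Section Superposition.
Context {R : realType}.
Local Open Scope ereal_scope.

(** For [c = +oo] both sides are 0 when [f] vanishes on [D], and both are [+oo] as soon as one term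
    is positive. *)
Lemma esumZe (T : choiceType) (D : set T) (c : \bar R) (f : T -> \bar R) :
  0 <= c -> (forall x, 0 <= f x) ->
  \esum_(x in D) (c * f x) = c * \esum_(x in D) f x.
Proof.
move=> c0 f0; case: c c0 => [c| |] // c0; first exact: esumZ.
have [fz|] := pselect (forall x, D x -> f x = 0).
  by rewrite !esum1 ?mule0// => x Dx; rewrite fz// mule0.
move/existsNP => [x /not_implyP[Dx /eqP fx]].
have gt0 : 0 < f x by rewrite lt_def fx f0.
have ge (h : T -> \bar R) : (forall y, 0 <= h y) -> h x <= \esum_(y in D) h y.
  move=> h0; rewrite (esumID [set x])// setI1 mem_set// esum_set1// leeDl//.
  exact: esum_ge0.
rewrite [RHS]gt0_mulye; last exact: lt_le_trans gt0 (ge _ f0).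
apply/eqP; rewrite -leye_eq.
by rewrite (le_trans _ (ge _ _)) ?gt0_mulye// => y; rewrite mule_ge0.
Qed.

Lemma wsumDw (T : choiceType) (v w : T -> R) (F : T -> \bar R) :
  (forall x, (0 <= v x)%R) -> (forall x, (0 <= w x)%R) ->
  (forall x, 0 <= F x) ->
  wsum (fun x => v x + w x)%R F = wsum v F + wsum w F.
Proof.
move=> v0 w0 F0; rewrite /wsum -esumD; last 2 first.
  by move=> x _; rewrite mule_ge0// lee_fin.
  by move=> x _; rewrite mule_ge0// lee_fin.
by apply: eq_esum => x _; rewrite EFinD ge0_muleDl// lee_fin.
Qed.

Lemma wsumZw (T : choiceType) (c : R) (w : T -> R) (F : T -> \bar R) :
  (0 <= c)%R -> (forall x, (0 <= w x)%R) -> (forall x, 0 <= F x) ->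
  wsum (fun x => c * w x)%R F = c%:E * wsum w F.
Proof.
move=> c0 w0 F0; rewrite /wsum -esumZ//; last first.
  by move=> x; rewrite mule_ge0// lee_fin.
by apply: eq_esum => x _; rewrite EFinM muleA.
Qed.

Lemma wsumn_cst (T : choiceType) (w : T -> R) (m : R) n (c : \bar R) :
  (forall x, (0 <= w x)%R) -> wsum w (fun=> 1) = m%:E -> 0 <= c ->
  wsumn w n (fun=> c) = (m ^+ n)%:E * c.
Proof.
move=> w0 wm c0; elim: n => /= [|n ->]; first by rewrite mul1e.
have m0 : (0 <= m)%R by rewrite -lee_fin -wm; apply: wsum_ge0.
rewrite exprS EFinM -muleA -wm [RHS]muleC /wsum -esumZe//; last 2 first.
  by rewrite mule_ge0// lee_fin exprn_ge0.
  by move=> x; rewrite mule1 lee_fin.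
by apply: eq_esum => x _; rewrite mule1 muleC.
Qed.

Lemma esum_expR (x : R) : (0 <= x)%R ->
  \esum_(n in [set: nat]) (n`!%:R^-1 * x ^+ n)%:E = (expR x)%:E.
Proof.
move=> x0; rewrite -nneseries_esumT; last first.
  by move=> n; rewrite lee_fin mulr_ge0 ?exprn_ge0.
rewrite expRE -EFin_lim; last first.
  rewrite /pseries/=; under eq_fun do rewrite mulrC.
  exact: is_cvg_series_exp_coeff.
apply/congr_lim/funext => n/=; rewrite /pseries/= /series/= -sumEFin//.
Qed.

(** The binomial sum of ['C(n, i) K i (n - i)], given by Pascal's rule because each unfolding step
    classifies one of the [n] points. *)
Fixpoint conv n (K : nat -> nat -> \bar R) : \bar R :=
  if n is n'.+1 then
    conv n' (fun i j => K i.+1 j) + conv n' (fun i j => K i j.+1)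
  else K 0%N 0%N.

Lemma conv_ge0 n K : (forall i j, 0 <= K i j) -> 0 <= conv n K.
Proof. by elim: n K => //= n IH K K0; rewrite adde_ge0 ?IH. Qed.

Lemma eq_conv n K K' : (forall i j, K i j = K' i j) -> conv n K = conv n K'.
Proof. by move=> KK; congr conv; apply/funext => i; apply/funext => j. Qed.

Lemma conv_wsum n (T : choiceType) (w : T -> R) (K : T -> nat -> nat -> \bar R) :
  (forall x, (0 <= w x)%R) -> (forall x i j, 0 <= K x i j) ->
  conv n (fun i j => wsum w (fun x => K x i j)) = wsum w (fun x => conv n (K x)).
Proof.
move=> w0; elim: n K => //= n IH K K0.
rewrite (IH (fun x i j => K x i.+1 j))// (IH (fun x i j => K x i j.+1))//.
by rewrite -wsumD// => x; exact: conv_ge0.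
Qed.

Lemma convZ n (c : R) (K : nat -> nat -> \bar R) :
  (0 <= c)%R -> (forall i j, 0 <= K i j) ->
  conv n (fun i j => c%:E * K i j) = c%:E * conv n K.
Proof.
move=> c0; elim: n K => //= n IH K K0.
by rewrite (IH (fun i j => K i.+1 j))// (IH (fun i j => K i j.+1))//
  ge0_muleDr// conv_ge0.
Qed.

Lemma conv_binomial n (K : nat -> nat -> \bar R) : (forall i j, 0 <= K i j) ->
  conv n K = \sum_(0 <= i < n.+1) ('C(n, i)%:R%:E * K i (n - i)%N).
Proof.
elim: n K => [|n IH] K K0 /=; first by rewrite big_nat1 bin0 mul1e.
rewrite !IH// [RHS]big_nat_recl//= bin0 mul1e subn0.
under [in RHS]eq_bigr => i _ do
  rewrite binS natrD EFinD ge0_muleDl ?lee_fin// subSS.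
rewrite big_split/= addeA addeC; congr (_ + _).
rewrite [in RHS]big_nat_recr//= bin_small// mul0e adde0.
rewrite [in LHS]big_nat_recl//= bin0 mul1e subn0; congr (_ + _).
by apply: eq_big_nat => i /andP[_ ni]; rewrite subnSK.
Qed.

(** Product of exponential generating series: ['C(n, i) / n! = 1 / (i! (n - i)!)], and the pairs
    [(n, i)] with [i <= n] are reindexed by [(i, n - i)]. *)
Lemma esum_conv (K : nat -> nat -> \bar R) : (forall i j, 0 <= K i j) ->
  \esum_(n in [set: nat]) ((n`!%:R^-1)%:E * conv n K) =
  \esum_(i in [set: nat]) \esum_(j in [set: nat])
     ((i`!%:R^-1)%:E * ((j`!%:R^-1)%:E * K i j)).
Proof.
move=> K0; set f := fun i j => (i`!%:R^-1)%:E * ((j`!%:R^-1)%:E * K i j).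
have f0 i j : 0 <= f i j by rewrite !mule_ge0// lee_fin invr_ge0.
transitivity (\esum_(n in [set: nat]) \esum_(i in `I_n.+1) f i (n - i)%N).
  apply: eq_esum => n _.
  rewrite conv_binomial// ge0_sume_distrr; last first.
    by move=> i _; rewrite mule_ge0// lee_fin.
  rewrite esum_fset//.
  rewrite big_mkord -fsbig_ord; apply: eq_bigr => i _.
  rewrite /f !muleA -!EFinM; congr (_%:E * _).
  have := bin_fact (ltnSE (ltn_ord i)); move/(congr1 (fun x => x%:R : R)).
  rewrite !natrM => <-.
  have nz (m : nat) : (m`!%:R : R) != 0%R by rewrite pnatr_eq0 -lt0n fact_gt0.
  have cnz : ('C(n, i)%:R : R) != 0%R.
    by rewrite pnatr_eq0 -lt0n bin_gt0 -ltnS ltn_ord.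
  by field; rewrite !nz cnz.
rewrite esum_esum// [RHS]esum_pair//.
rewrite (@reindex_esum _ _ _ [set: nat * nat]
  ([set: nat] `*`` (fun n => `I_n.+1)) (fun p => (p.1 + p.2, p.1)%N)).
  by apply: eq_esum => -[i j] _ /=; rewrite addKn.
split.
- by move=> [i j] _; split => //=; rewrite ltnS leq_addr.
- by move=> [i j] [i' j'] _ _ /= [] + ii; rewrite ii => /addnI ->.
- move=> [n i] [_ /= ni]; exists (i, n - i)%N => //=.
  by rewrite subnKC.
Qed.

(** Each of the [n] points comes from [v] or from [w]. Listing all points of [v] first is allowed
    because [G] does not see the order. *)
Lemma wsumn_superpose (T : choiceType) (v w : T -> R) n (G : seq T -> \bar R) :
  (forall x, (0 <= v x)%R) -> (forall x, (0 <= w x)%R) -> (forall l, 0 <= G l) ->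
  (forall l l', perm_eq l l' -> G l = G l') ->
  wsumn (fun x => v x + w x)%R n G =
  conv n (fun i j => wsumn v i (fun l1 => wsumn w j (fun l2 => G (l1 ++ l2)))).
Proof.
move=> v0 w0; elim: n G => //= n IH G G0 Gp.
have vw0 x : (0 <= v x + w x)%R by rewrite addr_ge0.
under eq_wsum => x.
  rewrite IH//; last by move=> l l' ll; apply: Gp; rewrite perm_cons.
  over.
have K0 x i j : 0 <= wsumn v i (fun l1 => wsumn w j (fun l2 => G (x :: l1 ++ l2))).
  by apply: wsumn_ge0 => // l1; exact: wsumn_ge0.
rewrite wsumDw//; last by move=> x; exact: conv_ge0.
congr (_ + _).
  by rewrite -conv_wsum.
rewrite -conv_wsum//; apply: eq_conv => i j.
under [RHS]eq_wsumn => l1 _ do rewrite /wsum.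
rewrite wsumn_esum//; last first.
  by move=> l1 x; rewrite mule_ge0 ?lee_fin//; exact: wsumn_ge0.
rewrite /wsum; apply: eq_esum => x _.
rewrite wsumnZ//; last by move=> l1; exact: wsumn_ge0.
congr (_ * _); apply: eq_wsumn => // l1 _; apply: eq_wsumn => // l2 _.
(* The new point comes from [w], so it has to be moved past the points [l1] of [v]. *)
by apply: Gp; rewrite -cat_cons perm_sym -[x :: l2]cat1s perm_catCA.
Qed.

Lemma poisum_superpose (T : choiceType) (v w : T -> R) (G : seq T -> \bar R) :
  (forall x, (0 <= v x)%R) -> (forall x, (0 <= w x)%R) -> (forall l, 0 <= G l) ->
  (forall l l', perm_eq l l' -> G l = G l') ->
  poisum v (fun l1 => poisum w (fun l2 => G (l1 ++ l2))) =
  poisum (fun x => v x + w x)%R G.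
Proof.
move=> v0 w0 G0 Gp; rewrite /poisum.
under [RHS]eq_esum => n _ do rewrite wsumn_superpose//.
rewrite esum_conv; last first.
  by move=> i j; apply: wsumn_ge0 => // l1; exact: wsumn_ge0.
apply: eq_esum => i _.
have f0 (j : nat) l1 : 0 <= (j`!%:R^-1)%:E * wsumn w j (fun l2 => G (l1 ++ l2)).
  by rewrite mule_ge0 ?lee_fin ?invr_ge0//; exact: wsumn_ge0.
rewrite wsumn_esum// esumZ ?invr_ge0//; last first.
  move=> j; rewrite mule_ge0 ?lee_fin ?invr_ge0//.
  by apply: wsumn_ge0 => // l1; exact: wsumn_ge0.
congr (_ * _); apply: eq_esum => j _; rewrite wsumnZ ?invr_ge0//.
by move=> l1; exact: wsumn_ge0.
Qed.

(** * Thinning of a Poisson process *)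

Section Thinning.
Variables (X Y : choiceType) (w : X -> R) (w' : Y -> R) (g : X -> option Y).
Variables (e : Y -> Y -> Prop) (r : R).
Hypothesis w0 : forall x, (0 <= w x)%R.
Hypothesis w'0 : forall y, (0 <= w' y)%R.
Hypothesis kept : forall f : Y -> \bar R, (forall y, 0 <= f y) ->
  (forall y y', e y y' -> f y = f y') ->
  wsum w (fun x => if g x is Some y then f y else 0) = wsum w' f.
Hypothesis deleted : wsum w (fun x => if g x is Some _ then 0 else 1) = r%:E.

(** [g] deletes a point or replaces it by its image. By [kept], [w'] describes the images only for
    test functions invariant under [e], which is later built from tree isomorphism. Hence [G] must
    be invariant under [e] in each point. *)
Lemma wsumn_thin n (G : nat -> seq Y -> \bar R) : (forall j l, 0 <= G j l) ->
  (forall j l1 y y' l2, e y y' -> G j (l1 ++ y :: l2) = G j (l1 ++ y' :: l2)) ->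
  wsumn w n (fun l => G (count (fun x => ~~ isSome (g x)) l) (pmap g l)) =
  conv n (fun i j => (r ^+ j)%:E * wsumn w' i (G j)).
Proof.
have r0 : (0 <= r)%R.
  by rewrite -lee_fin -deleted; apply: wsum_ge0 => // x; case: (g x).
elim: n G => [|n IH] G G0 Ge /=; first by rewrite mul1e.
pose Phi y := wsumn w n
  (fun l => G (count (fun x => ~~ isSome (g x)) l) (y :: pmap g l)).
pose C := wsumn w n
  (fun l => G (count (fun x => ~~ isSome (g x)) l).+1 (pmap g l)).
have Phi0 y : 0 <= Phi y by exact: wsumn_ge0.
have C0 : 0 <= C by exact: wsumn_ge0.
have K0 (H : seq Y -> \bar R) (i j : nat) : (forall l, 0 <= H l) ->
    0 <= (r ^+ j)%:E * wsumn w' i H.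
  by move=> H0; rewrite mule_ge0 ?wsumn_ge0// lee_fin exprn_ge0.
have PhiE y : Phi y =
    conv n (fun i j => (r ^+ j)%:E * wsumn w' i (fun l => G j (y :: l))).
  rewrite /Phi (IH (fun j l => G j (y :: l)))// => j l1 z z' l2 zz.
  exact: (Ge j (y :: l1)).
have CE : C = conv n (fun i j => (r ^+ j)%:E * wsumn w' i (G j.+1)).
  rewrite /C (IH (fun j => G j.+1))// => j; exact: Ge.
transitivity (wsum w (fun x => (if g x is Some y then Phi y else 0) +
    (if g x is Some _ then 0 else C))).
  by apply: eq_wsum => x; case: (g x) => [y|] /=; rewrite ?adde0 ?add0e.
rewrite wsumD//; last 2 first.
  by move=> x; case: (g x).
  by move=> x; case: (g x).
congr (_ + _).
  rewrite kept//; last first.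
    move=> y y' yy; apply: eq_wsumn => l _; exact: (Ge _ [::]).
  under eq_wsum do rewrite PhiE.
  rewrite -conv_wsum//; last by move=> *; exact: K0.
  apply: eq_conv => i j; rewrite wsumZ ?exprn_ge0//.
  by move=> y; exact: wsumn_ge0.
transitivity (C * r%:E).
  rewrite -deleted -esumZe//; last first.
    by move=> x; case: (g x); rewrite ?mule0 ?mule1// lee_fin.
  by apply: eq_esum => x _; case: (g x); rewrite ?mule0 ?mule1// muleC.
rewrite CE muleC -convZ//; last by move=> *; exact: K0.
by apply: eq_conv => i j; rewrite muleA -EFinM exprS.
Qed.

(** The number of deleted points is Poisson of mean [r] and independent of the kept points. This
    independence is what hides the random bit of the adversary. *)
Lemma poisum_thin (G : nat -> seq Y -> \bar R) : (forall j l, 0 <= G j l) ->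
  (forall j l1 y y' l2, e y y' -> G j (l1 ++ y :: l2) = G j (l1 ++ y' :: l2)) ->
  poisum w (fun l => G (count (fun x => ~~ isSome (g x)) l) (pmap g l)) =
  \esum_(j in [set: nat]) ((j`!%:R^-1 * r ^+ j)%:E * poisum w' (G j)).
Proof.
move=> G0 Ge; have r0 : (0 <= r)%R.
  by rewrite -lee_fin -deleted; apply: wsum_ge0 => // x; case: (g x).
rewrite /poisum.
under eq_esum => n _ do rewrite wsumn_thin//.
rewrite esum_conv; last first.
  by move=> i j; rewrite mule_ge0 ?lee_fin ?exprn_ge0//; exact: wsumn_ge0.
rewrite esum_swap; last first.
  move=> i j; rewrite !mule_ge0 ?lee_fin ?invr_ge0 ?exprn_ge0//.
  exact: wsumn_ge0.
apply: eq_esum => j _; rewrite -esumZ//; last 2 first.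
  by rewrite mulr_ge0 ?invr_ge0 ?exprn_ge0.
  by move=> i; rewrite mule_ge0 ?lee_fin ?invr_ge0//; exact: wsumn_ge0.
by apply: eq_esum => i _; rewrite !muleA -!EFinM; congr (_%:E * _); ring.
Qed.
End Thinning.
End Superposition.

(** * Children in the broadcast tree as a Poisson process *)

Section BroadcastExpectation.
Context {R : realType}.
Local Open Scope ereal_scope.

Lemma esum_restrict (T : choiceType) (A : set T) (f : T -> \bar R) :
  (forall x, ~ A x -> f x = 0) ->
  \esum_(x in [set: T]) f x = \esum_(x in A) f x.
Proof.
move=> fA; rewrite [RHS]esum_mkcond; apply: eq_esum => x _.
by case: ifPn => //; rewrite notin_setE => /fA.
Qed.

Lemma pweightZ (T : choiceType) (c : R) (w : T -> R) l :
  (pweight (fun x => c * w x) l =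
   c ^+ size l * (size l)`!%:R^-1 * \prod_(x <- l) w x)%R.
Proof.
rewrite /pweight big_split/= big_const_seq count_predT -Monoid.iteropE/=.
by rewrite -[iterop _ _ _ _]/(c ^+ size l)%R mulrCA mulrA.
Qed.

Lemma broadcast_pmf_ge0 (a b : R) d s t : (0 <= broadcast_pmf a b d s t)%R.
Proof.
elim: d s t => [|d IH] s t /=; first exact: ler0n.
case: t => x cs; case: ifP => // _.
by rewrite !mulr_ge0 ?poisson_pmf_ge0// prodr_ge0.
Qed.

Lemma broadcast_pmf_root (a b : R) d s t :
  root_label t != s -> broadcast_pmf a b d s t = 0%R.
Proof.
case: d t => [|d] [x cs] /= xs; last by rewrite (negbTE xs).
by case: eqP => // -[xs' _]; rewrite xs' eqxx in xs.
Qed.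

Lemma filter_root_label_neg s (l : seq (tree bool)) :
  all (fun c => root_label c == ~~ s) l -> [seq c <- l | root_label c == s] = [::].
Proof.
by elim: l => //= c l IH /andP[/eqP -> /IH ->]; case: s {IH}.
Qed.

(** Only lists with the own-spin children first carry mass, so the sum over lists is a sum over
    pairs of lists. Each Poisson mass function times its product of subtree weights is a [pweight]
    up to the exponential factor. *)
Lemma wsum_broadcast (a b : R) d s (F : tree bool -> \bar R) :
  (0 < a)%R -> (0 < b)%R -> (forall t, 0 <= F t) ->
  wsum (broadcast_pmf a b d.+1 s) F =
  (expR (- (a / 2 + b / 2)))%:E *
  poisum (fun c => a / 2 * broadcast_pmf a b d s c)%R (fun l1 =>
    poisum (fun c => b / 2 * broadcast_pmf a b d (~~ s) c)%R (fun l2 =>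
      F (Node s (l1 ++ l2)))).
Proof.
move=> a0 b0 F0.
have a20 : (0 < a / 2)%R by rewrite divr_gt0.
have b20 : (0 < b / 2)%R by rewrite divr_gt0.
set v := (fun c => a / 2 * _)%R; set w := (fun c => b / 2 * _)%R.
have v0 c : (0 <= v c)%R by rewrite mulr_ge0 ?broadcast_pmf_ge0// ltW.
have w0 c : (0 <= w c)%R by rewrite mulr_ge0 ?broadcast_pmf_ge0// ltW.
have pm t : 0 <= (broadcast_pmf a b d.+1 s t)%:E * F t.
  by rewrite mule_ge0// lee_fin broadcast_pmf_ge0.
rewrite /wsum esum_tree// (@esum_single _ _ s); last 2 first.
  exact: esum_ge0.
  by move=> x xs; apply: esum1 => cs _; rewrite broadcast_pmf_root// mul0e.
(* [A] holds the pairs with the right root spins, [B] the lists in canonical order; concatenation is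
   a bijection from [A] onto [B]. *)
pose A := [set p : seq (tree bool) * seq (tree bool) |
  all (fun c => root_label c == s) p.1 && all (fun c => root_label c == ~~ s) p.2].
pose B := [set cs : seq (tree bool) | cs =
  [seq c <- cs | root_label c == s] ++ [seq c <- cs | root_label c == ~~ s]].
have fl1 l1 l2 : A (l1, l2) -> [seq c <- l1 ++ l2 | root_label c == s] = l1.
  move=> /andP[/= /all_filterP h1 h2].
  by rewrite filter_cat h1 filter_root_label_neg ?cats0.
have fl2 l1 l2 : A (l1, l2) -> [seq c <- l1 ++ l2 | root_label c == ~~ s] = l2.
  move=> /andP[/= h1 /all_filterP h2].
  by rewrite filter_cat h2 filter_root_label_neg ?negbK.
rewrite (@esum_restrict _ B); last first.
  by move=> cs nB /=; rewrite eqxx/= (introF eqP nB) mul0e.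
rewrite (@reindex_esum _ _ _ A B (fun p => p.1 ++ p.2)); last first.
  split.
  - by move=> [l1 l2] lA; rewrite /B/= fl1// fl2.
  - move=> [l1 l2] [k1 k2]; rewrite !inE => lA kA /= lk.
    congr (_, _).
      by rewrite -(fl1 _ _ lA) lk; exact: fl1 kA.
    by rewrite -(fl2 _ _ lA) lk; exact: fl2 kA.
  - move=> cs cB; exists ([seq c <- cs | root_label c == s],
      [seq c <- cs | root_label c == ~~ s]); last exact: esym.
    by rewrite /A/= !filter_all.
rewrite poisumE//; last by move=> l; exact: poisum_ge0.
under [in RHS]eq_esum => l1 _.
  rewrite poisumE// -esumZ ?pweight_ge0//; last first.
    by move=> l2; rewrite mule_ge0// lee_fin pweight_ge0.
  over.
rewrite /= esum_pair; last first.
  by move=> l1 l2; rewrite !mule_ge0// lee_fin pweight_ge0.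
rewrite -esumZ ?expR_ge0//; last first.
  by move=> l; rewrite !mule_ge0// lee_fin pweight_ge0.
(* Outside [A] some subtree has the wrong root spin, and its weight is 0. *)
rewrite [RHS](@esum_restrict _ A); last first.
  have pw0 c s' l : ~~ all (fun c => root_label c == s') l ->
      pweight (fun t => c / 2 * broadcast_pmf a b d s' t)%R l = 0%R.
    move=> /allPn[t tl ts]; rewrite /pweight (big_rem t)//=.
    by rewrite broadcast_pmf_root// !(mulr0, mul0r).
  move=> [l1 l2] /negP; rewrite negb_and => /orP[] /= h.
    by rewrite /v (pw0 a)// !(mul0e, mule0).
  by rewrite /w (pw0 b)// !(mul0e, mule0).
apply: eq_esum => -[l1 l2] lA /=.
rewrite (fl1 _ _ lA) (fl2 _ _ lA) !eqxx/= !muleA -!EFinM; congr (_%:E * _).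
rewrite /v /w !pweightZ /poisson_pmf a20 b20 opprD expRD; ring.
Qed.

(** For a test function blind to order, superposition merges own-spin and opposite-spin children
    into a single Poisson process. *)
Lemma wsum_broadcast_sym (a b : R) d s (F : tree bool -> \bar R) :
  (0 < a)%R -> (0 < b)%R -> (forall t, 0 <= F t) ->
  (forall l l', perm_eq l l' -> F (Node s l) = F (Node s l')) ->
  wsum (broadcast_pmf a b d.+1 s) F =
  (expR (- (a / 2 + b / 2)))%:E *
  poisum (fun c => a / 2 * broadcast_pmf a b d s c +
                   b / 2 * broadcast_pmf a b d (~~ s) c)%R (F \o Node s).
Proof.
move=> a0 b0 F0 Fp; rewrite wsum_broadcast//; congr (_ * _).
rewrite -poisum_superpose//.
- by move=> c; rewrite mulr_ge0 ?broadcast_pmf_ge0// divr_ge0// ltW.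
- by move=> c; rewrite mulr_ge0 ?broadcast_pmf_ge0// divr_ge0// ltW.
- by move=> l; exact: F0.
Qed.

Lemma poisum_cst (T : choiceType) (w : T -> R) (m : R) (c : \bar R) :
  (forall x, (0 <= w x)%R) -> wsum w (fun=> 1) = m%:E -> 0 <= c ->
  poisum w (fun=> c) = (expR m)%:E * c.
Proof.
move=> w0 wm c0.
have m0 : (0 <= m)%R by rewrite -lee_fin -wm; apply: wsum_ge0.
rewrite -esum_expR// muleC -esumZe//; last first.
  by move=> n; rewrite lee_fin mulr_ge0 ?invr_ge0 ?exprn_ge0.
by apply: eq_esum => n _; rewrite (wsumn_cst _ _ wm)// muleA -EFinM muleC.
Qed.

Lemma broadcast_mass (a b : R) d s : (0 < a)%R -> (0 < b)%R ->
  wsum (broadcast_pmf a b d s) (fun=> 1) = 1.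
Proof.
move=> a0 b0; elim: d s => [|d IH] s.
  rewrite /wsum (@esum_single _ _ (Node s [::])) /= ?eqxx ?mule1//.
  by move=> t /negbTE ->; rewrite mul0e.
rewrite wsum_broadcast_sym//.
rewrite -[X in poisum _ X]/(fun=> 1) (@poisum_cst _ _ (a / 2 + b / 2)%R)//.
- by rewrite mule1 -EFinM -expRD addrC subrr expR0.
- by move=> c; rewrite addr_ge0// mulr_ge0 ?broadcast_pmf_ge0// divr_ge0// ltW.
rewrite wsumDw// => [|c|c]; last 2 first.
- by rewrite mulr_ge0 ?broadcast_pmf_ge0// divr_ge0// ltW.
- by rewrite mulr_ge0 ?broadcast_pmf_ge0// divr_ge0// ltW.
rewrite !wsumZw ?divr_ge0 ?ltW//; [|exact: broadcast_pmf_ge0..].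
by rewrite !IH !mule1.
Qed.

Lemma poisumD (T : choiceType) (w : T -> R) (F G : seq T -> \bar R) :
  (forall x, (0 <= w x)%R) -> (forall l, 0 <= F l) -> (forall l, 0 <= G l) ->
  poisum w (fun l => F l + G l) = poisum w F + poisum w G.
Proof.
move=> w0 F0 G0; rewrite !poisumE//; last by move=> l; rewrite adde_ge0.
rewrite -esumD; last 2 first.
  by move=> l _; rewrite mule_ge0// lee_fin pweight_ge0.
  by move=> l _; rewrite mule_ge0// lee_fin pweight_ge0.
by apply: eq_esum => l _; rewrite ge0_muleDr.
Qed.

Lemma poisum_size1 (T : choiceType) (w : T -> R) (F : seq T -> \bar R) :
  (forall x, (0 <= w x)%R) -> (forall l, 0 <= F l) ->
  (forall l, size l != 1%N -> F l = 0) ->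
  poisum w F = wsum w (fun x => F [:: x]).
Proof.
move=> w0 F0 F1; rewrite /poisum (@esum_single _ _ 1%N).
- by rewrite -[1`!]/1%N mulr1n invr1 mul1e.
- by rewrite mule_ge0 ?wsumn_ge0// lee_fin invr_ge0.
- move=> n n1; rewrite (@eq_wsumn _ _ _ _ _ (fun=> 0)).
    rewrite wsumnE// -esum_seqnE ?esum1 ?mule0// => l *; rewrite mule0//.
  by move=> l ln; rewrite F1// ln.
Qed.

Lemma esum_seq1 (T : choiceType) (f : seq T -> \bar R) : (forall l, 0 <= f l) ->
  \esum_(l in [set l | size l = 1%N]) f l = \esum_(x in [set: T]) f [:: x].
Proof. by move=> f0; rewrite esum_seqnE. Qed.

Lemma wsum_prod_bool (T : choiceType) (w : bool * T -> R) (F : bool * T -> \bar R) :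
  (forall x, (0 <= w x)%R) -> (forall x, 0 <= F x) ->
  wsum w F = wsum (fun o => w (true, o)) (fun o => F (true, o)) +
             wsum (fun o => w (false, o)) (fun o => F (false, o)).
Proof.
move=> w0 F0; rewrite -(@esum_bool _ (fun c => wsum _ (fun o => F (c, o))));
  last by move=> c; exact: wsum_ge0.
rewrite esum_pair; last by move=> c o; rewrite mule_ge0// lee_fin.
by apply: eq_esum => -[].
Qed.

(** Forgetting a mark turns a Poisson process into one whose intensity is summed over the marks. *)
Lemma poisum_map_snd (T : choiceType) (w : bool * T -> R) (F : seq T -> \bar R) :
  (forall x, (0 <= w x)%R) -> (forall l, 0 <= F l) ->
  poisum w (fun l => F (map snd l)) =
  poisum (fun o => w (true, o) + w (false, o))%R F.
Proof.
move=> w0 F0; apply: eq_esum => n _; congr (_ * _).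
elim: n F F0 => //= n IH F F0.
under eq_wsum => x do rewrite (IH (fun l => F (x.2 :: l)))//.
rewrite wsum_prod_bool//; last first.
  by move=> x; apply: wsumn_ge0 => // o; rewrite addr_ge0.
rewrite wsumDw// => o.
by apply: wsumn_ge0 => // o'; rewrite addr_ge0.
Qed.
End BroadcastExpectation.

(** * The cutting adversary *)

Section TreeIso.
Variable L : eqType.

Fixpoint tree_iso_refl (t : tree L) : tree_iso t t.
Proof.
case: t => x cs; constructor; elim: cs => [|c cs IH]; first by constructor.
exact: (@ForestIsoCons _ c c cs [::] cs).
Qed.

Lemma forest_iso_refl (cs : seq (tree L)) : forest_iso cs cs.
Proof.
elim: cs => [|c cs IH]; first by constructor.
exact: (@ForestIsoCons _ c c cs [::] cs (tree_iso_refl c)).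
Qed.

(** With [tree_iso_child], this supplies the symmetry that superposition and thinning ask of test
    functions. *)
Lemma tree_iso_perm x (l l' : seq (tree L)) :
  perm_eq l l' -> tree_iso (Node x l) (Node x l').
Proof.
move=> ll; constructor; elim: l l' ll => [|c l IH] l' ll.
  by move: ll; rewrite perm_sym => /perm_nilP ->; constructor.
have cl : c \in l' by rewrite -(perm_mem ll) mem_head.
case/splitPr: cl ll => l1 l2 ll; constructor; first exact: tree_iso_refl.
by apply: IH; rewrite -(perm_cons c) (permPl ll) perm_catC/= perm_cons perm_catC.
Qed.

Lemma tree_iso_child x (l1 l2 : seq (tree L)) c c' : tree_iso c c' ->
  tree_iso (Node x (l1 ++ c :: l2)) (Node x (l1 ++ c' :: l2)).
Proof.
move=> cc; constructor; elim: l1 => [|y l1 IH] /=.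
  exact: (@ForestIsoCons _ _ _ _ [::] _ cc (forest_iso_refl _)).
exact: (@ForestIsoCons _ _ _ _ [::] _ (tree_iso_refl y) IH).
Qed.

End TreeIso.

Definition childless (L : Type) (t : tree L) : bool := let: Node _ cs := t in nilp cs.

Definition dead_opposite (s : bool) (t : tree bool) : bool :=
  (root_label t == ~~ s) && childless t.

(* The presence of a deleted [dead_opposite] child is a random bit that stays
   hidden from the estimator: it makes the deletion of the path from the parent
   through [v] to its grandchild rare enough not to reverse their correlation. *)
Definition cut_edge (s : bool) (v : tree bool) : bool :=
  let: Node x ws := v in
  [&& x == ~~ s, has (dead_opposite x) ws &
      if [seq w <- ws | ~~ dead_opposite x w] is [:: w]
      then root_label w == ~~ x else false].

(** Depths up to 2 are left alone, so in a block the grandchildren root trees of depth at least 1: a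
    childless one is not a leaf, and [observe] hides its spin. *)
Fixpoint adversary (d : nat) (t : tree bool) : tree bool :=
  match d with
  | (e.+1 as d').+2 =>
    let: Node s cs := t in
    Node s (pmap (fun v => let: Node x ws := v in
      if cut_edge s v then None
      else Some (Node x (pmap (fun w =>
        if dead_opposite x w then None else Some (adversary d' w)) ws))) cs)
  | _ => t
  end.

Fixpoint cut_tree_refl (t : tree bool) : cut_tree t t.
Proof.
by case: t => x cs; constructor; elim: cs => [|c cs IH]; constructor.
Qed.

Lemma cut_children_pmap s (g : tree bool -> option (tree bool)) cs :
  (forall c, if g c is Some c' then cut_tree c c' else root_label c = ~~ s) ->
  cut_children s cs (pmap g cs).
Proof.
move=> gP; elim: cs => /= [|c cs IH]; first by constructor.
by have := gP c; case: (g c) => [c'|] /= h; constructor.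
Qed.

Lemma adversary_cutting : cutting_adversary adversary.
Proof.
(* Strong induction, since [adversary] recurses two levels down. *)
move=> d t; have [n] := ubnP d; elim: n d t => // n IH [|[|[|d]]] t dn;
  try exact: cut_tree_refl.
case: t => s cs; constructor; apply: cut_children_pmap => -[x ws].
case: ifPn => [/and3P[/eqP-> //]|_].
constructor; apply: cut_children_pmap => w.
case: ifPn => [/andP[/eqP-> //]|_]; apply: (IH d.+1 w).
by rewrite (leq_trans _ (ltnSE dn)).
Qed.

(** One block of [adversary] fused with [observe]: [None] is a deletion. This is the form that
    [poisum_thin] takes. *)
Definition observed_grandchild d (x : bool) (w : tree bool) :=
  if dead_opposite x w then None else Some (observe d (adversary d w)).

Definition observed_child d (s : bool) (v : tree bool) :=
  let: Node x ws := v in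
  if cut_edge s v then None
  else Some (Node (None : option bool) (pmap (observed_grandchild d x) ws)).

Lemma map_pmap (S T U : Type) (f : T -> U) (g : S -> option T) l :
  map f (pmap g l) = pmap (fun x => omap f (g x)) l.
Proof. by elim: l => //= x l <-; case: (g x). Qed.

Lemma observe_adversary d s cs :
  observe d.+3 (adversary d.+3 (Node s cs)) =
  Node None (pmap (observed_child d.+1 s) cs).
Proof.
rewrite [observe _ _]/= map_pmap; congr (Node _ _); apply: eq_pmap => -[x ws].
rewrite /observed_child; case: ifPn => // _.
rewrite [omap _ _]/=; congr (Some (Node _ _)).
rewrite map_pmap; apply: eq_pmap => w.
by rewrite /observed_grandchild; case: ifP.
Qed.

Lemma tree_iso_invariant_perm (T : Type) (F : tree (option bool) -> T) :
  (forall o o', tree_iso o o' -> F o = F o') ->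
  forall l l', perm_eq l l' -> F (Node None l) = F (Node None l').
Proof. by move=> Fi l l' ll; apply: Fi; exact: tree_iso_perm. Qed.

(** Also yields that [x] is finite, so that masses can be found by complement. *)
Lemma adde_EFin_inj (R : realType) (x : \bar R) (p q : R) :
  (p%:E + x = q%:E -> x = (q - p)%:E)%E.
Proof. by case: x => [x| |] //= [<-]; rewrite addrAC subrr add0r. Qed.

(** * Poisson sums split by the number of points *)

Section PoissonSeries.
Context {R : realType}.
Local Open Scope ereal_scope.

Lemma esum_expR_mul (r : R) (c : \bar R) : (0 <= r)%R -> 0 <= c ->
  \esum_(j in [set: nat]) ((j`!%:R^-1 * r ^+ j)%:E * c) = (expR r)%:E * c.
Proof.
move=> r0 c0; rewrite -esum_expR// muleC -esumZe//; last first.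
  by move=> n; rewrite lee_fin mulr_ge0 ?invr_ge0 ?exprn_ge0.
by apply: eq_esum => n _; rewrite muleC.
Qed.

(** The weights of [j >= 1] add up to [expR r - 1]. This evaluates quantities that depend only on
    whether some point was deleted. *)
Lemma esum_expR_head (r : R) (x y : \bar R) : (0 <= r)%R -> 0 <= x -> 0 <= y ->
  \esum_(j in [set: nat]) ((j`!%:R^-1 * r ^+ j)%:E * (if (0 < j)%N then y else x)) =
  x + (expR r - 1)%:E * y.
Proof.
move=> r0 x0 y0.
have c0 (n : nat) : 0 <= (n`!%:R^-1 * r ^+ n)%:E.
  by rewrite lee_fin mulr_ge0 ?invr_ge0 ?exprn_ge0.
have z1 : (0`!%:R^-1 * r ^+ 0)%R = 1%R :> R by rewrite mulr1 -[0`!]/1%N invr1.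
rewrite (esumID [set 0%N]); last by move=> j _; rewrite mule_ge0//; case: ifP.
rewrite setTI esum_set1; last by rewrite mule_ge0.
rewrite z1 mul1e; congr (_ + _).
rewrite setTI muleC.
transitivity (\esum_(j in ~` [set 0%N]) (y * (j`!%:R^-1 * r ^+ j)%:E)).
  by apply: eq_esum => -[|j] //= _; rewrite muleC.
rewrite esumZe//; congr (_ * _); apply: adde_EFin_inj.
by rewrite -(esum_expR r0) [in RHS](esumID [set 0%N])// !setTI esum_set1// z1.
Qed.

Lemma poisum_size_ne1 (T : choiceType) (w : T -> R) (m : R) :
  (forall o, (0 <= w o)%R) -> wsum w (fun=> 1) = m%:E ->
  poisum w (fun l => if size l != 1%N then 1 else 0) = (expR m - m)%:E.
Proof.
move=> w0 wm; apply: adde_EFin_inj.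
rewrite -[X in _ = X]mule1 -(poisum_cst w0 wm lee01).
rewrite -wm -(@poisum_size1 _ _ w (fun l => if size l == 1%N then 1 else 0))//.
- rewrite -poisumD//; [|by move=> l; case: ifP..].
  by congr poisum; apply/funext => l; case: eqP; rewrite ?adde0 ?add0e.
- by move=> l; case: ifP.
- by move=> l /negbTE ->.
Qed.

Lemma poisum_nil (T : choiceType) (w : T -> R) (F : seq T -> \bar R) :
  (forall x, (0 <= w x)%R) -> (forall l, 0 <= F l) ->
  poisum w F = F [::] + poisum w (fun l => if nilp l then 0 else F l).
Proof.
move=> w0 F0.
rewrite -[X in _ = X + _](_ : poisum w (fun l => if nilp l then F l else 0) = _).
  rewrite -poisumD//; last 2 first.
    by move=> l; case: ifP.
    by move=> l; case: ifP.
  by congr poisum; apply/funext => l; case: ifP; rewrite ?adde0 ?add0e.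
rewrite poisumE//; last by move=> l; case: ifP.
rewrite (@esum_single _ _ [::])//=.
- by rewrite /pweight big_nil mulr1 -[0`!]/1%N invr1 mul1e.
- by rewrite mule_ge0// lee_fin pweight_ge0.
- by move=> [|c l] //= _; rewrite mule0.
Qed.

End PoissonSeries.

(** * Law of the observation of a two-level block *)

Section Block.
Context {R : realType}.
Variables a b : R.
Hypotheses (a0 : 0 < a) (b0 : 0 < b).
Local Notation T := (tree (option bool)).
Local Notation empty := (Node None [::] : T).
Local Notation dl := (expR (- (a / 2 + b / 2))).
Implicit Type L : bool -> T -> R.

Local Open Scope ereal_scope.

(** Moves a weight on lists of children to observations whose root spin is hidden. *)
Definition node_weight (p : seq T -> R) (o : T) : R :=
  if o is Node None l then p l else 0%R.

Lemma wsum_node_weight (p : seq T -> R) (f : T -> \bar R) :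
  (forall l, (0 <= p l)%R) -> (forall o, 0 <= f o) ->
  wsum (node_weight p) f = \esum_(l in [set: seq T]) ((p l)%:E * f (Node None l)).
Proof.
move=> p0 f0.
have g0 o : 0 <= (node_weight p o)%:E * f o.
  by case: o => [[y|] l] /=; rewrite ?mul0e// mule_ge0// lee_fin.
rewrite /wsum esum_tree// (@esum_single _ _ None)//; first exact: esum_ge0.
by case=> // y _; rewrite esum1// => l _; rewrite mul0e.
Qed.

(* [L s] is the law of the observation on the event that the root, of spin [s],
   has a child in the precursor tree, up to isomorphism of observations. *)
Definition live_law d L : Prop := forall s (F : bool -> T -> \bar R),
  (forall c o, 0 <= F c o) ->
  (forall c o o', tree_iso o o' -> F c o = F c o') ->
  wsum (broadcast_pmf a b d s)
    (fun t => F (~~ childless t) (observe d (adversary d t))) =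
  wsum (L s) (F true) + dl%:E * F false empty.

(** [dl] is the probability of having no child, so [dead_rate] is the mean number of erased children
    of the middle vertex of a block, and [grandchild_mass] that of the remaining ones. *)
Definition dead_rate : R := (b / 2 * dl)%R.
Definition grandchild_mass : R := (a / 2 + b / 2 - dead_rate)%R.

(** Intensity of the observed grandchildren below a middle vertex of spin [x], of its own spin here
    and of the opposite spin in [opp_weight]. The childless ones, of mass [dl], appear only here,
    since the opposite ones are erased. *)
Definition own_weight L x (o : T) : R :=
  (a / 2 * (L x o + dl * (o == empty)%:R))%R.
Definition opp_weight L x (o : T) : R := (b / 2 * L (~~ x) o)%R.
Definition grandchild_weight L x (o : T) : R :=
  (own_weight L x o + opp_weight L x o)%R.
Definition mark_weight L x (y : bool * T) : R :=
  if y.1 then own_weight L x y.2 else opp_weight L x y.2.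

(* [kap] is the probability that [v] survives when its only observed child has
   the opposite spin: 1 if [v] has the spin of its parent, and otherwise the
   probability that [v] has no [dead_opposite] child. *)
Definition path_weight (kap : R) L x (l : seq T) : R :=
  if l is [:: o] then (own_weight L x o + kap * opp_weight L x o)%R
  else pweight (grandchild_weight L x) l.

Definition kept_weight (kap : R) L x (o : T) : R :=
  (expR (- grandchild_mass) * node_weight (path_weight kap L x) o)%R.

Definition child_weight L s (o : T) : R :=
  (a / 2 * kept_weight 1 L s o +
   b / 2 * kept_weight (expR (- dead_rate)) L (~~ s) o)%R.

Section Weights.
Variable L : bool -> T -> R.
Hypothesis L0 : forall s o, (0 <= L s o)%R.

Let a20 : (0 <= a / 2)%R. Proof. by rewrite divr_ge0// ltW. Qed.
Let b20 : (0 <= b / 2)%R. Proof. by rewrite divr_ge0// ltW. Qed.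

Lemma dead_rate_ge0 : (0 <= dead_rate)%R.
Proof. by rewrite mulr_ge0 ?expR_ge0. Qed.

Lemma own_weight_ge0 x o : (0 <= own_weight L x o)%R.
Proof. by rewrite mulr_ge0// addr_ge0// mulr_ge0 ?expR_ge0. Qed.

Lemma opp_weight_ge0 x o : (0 <= opp_weight L x o)%R.
Proof. by rewrite mulr_ge0. Qed.

Lemma grandchild_weight_ge0 x o : (0 <= grandchild_weight L x o)%R.
Proof. by rewrite addr_ge0 ?own_weight_ge0 ?opp_weight_ge0. Qed.

Lemma mark_weight_ge0 x y : (0 <= mark_weight L x y)%R.
Proof. by rewrite /mark_weight; case: ifP; rewrite ?own_weight_ge0 ?opp_weight_ge0. Qed.

Lemma path_weight_ge0 (kap : R) x l : (0 <= kap)%R -> (0 <= path_weight kap L x l)%R.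
Proof.
move=> k0; rewrite /path_weight; case: l => [|o [|o' l]];
  try exact/pweight_ge0/grandchild_weight_ge0.
by rewrite addr_ge0 ?own_weight_ge0// mulr_ge0 ?opp_weight_ge0.
Qed.

Lemma kept_weight_ge0 (kap : R) x o : (0 <= kap)%R -> (0 <= kept_weight kap L x o)%R.
Proof.
move=> k0; rewrite /kept_weight mulr_ge0 ?expR_ge0//.
by case: o => [[y|] l] //=; exact: path_weight_ge0.
Qed.

Lemma child_weight_ge0 s o : (0 <= child_weight L s o)%R.
Proof. by rewrite addr_ge0// mulr_ge0// kept_weight_ge0// expR_ge0. Qed.

Lemma wsum_own_weight x (f : T -> \bar R) : (forall o, 0 <= f o) ->
  wsum (own_weight L x) f = (a / 2)%:E * (wsum (L x) f + dl%:E * f empty).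
Proof.
move=> f0.
have e0 (o : T) : (0 <= dl * (o == empty)%:R)%R by rewrite mulr_ge0 ?expR_ge0.
rewrite wsumZw//; last by move=> o; rewrite addr_ge0.
congr (_ * _); rewrite wsumDw//; congr (_ + _).
rewrite /wsum (@esum_single _ _ empty) ?eqxx ?mulr1//.
- by rewrite mule_ge0// lee_fin expR_ge0.
- by move=> o /negbTE ->; rewrite mulr0 mul0e.
Qed.

Lemma wsum_opp_weight x (f : T -> \bar R) : (forall o, 0 <= f o) ->
  wsum (opp_weight L x) f = (b / 2)%:E * wsum (L (~~ x)) f.
Proof. by move=> f0; rewrite wsumZw. Qed.

Lemma wsum_kept_weight (kap : R) x (f : T -> \bar R) : (0 <= kap)%R ->
  (forall o, 0 <= f o) ->
  wsum (kept_weight kap L x) f = (expR (- grandchild_mass))%:E *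
    (poisum (grandchild_weight L x)
       (fun l => if size l == 1%N then 0 else f (Node None l)) +
     (wsum (own_weight L x) (fun o => f (Node None [:: o])) +
      kap%:E * wsum (opp_weight L x) (fun o => f (Node None [:: o])))).
Proof.
move=> k0 f0; have p0 l := path_weight_ge0 x l k0.
rewrite wsumZw ?expR_ge0//; last by case=> [[y|] l] //=.
congr (_ * _); rewrite wsum_node_weight//.
rewrite (esumID [set l | size l = 1%N]); last first.
  by move=> l _; rewrite mule_ge0// lee_fin.
rewrite addeC !setTI; congr (_ + _).
  rewrite poisumE; [|exact: grandchild_weight_ge0|by move=> l; case: ifP].
  rewrite [RHS](@esum_restrict _ _ (~` [set l | size l = 1%N])).
    apply: eq_esum => l /= l1; rewrite (introF eqP l1).
    by case: l l1 => [|o [|o' l]].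
  by move=> l /contrapT /= ->; rewrite mule0.
rewrite esum_seq1; last by move=> l; rewrite mule_ge0// lee_fin.
rewrite -wsumZw//; last exact: opp_weight_ge0.
rewrite -wsumDw//; first exact: own_weight_ge0.
by move=> o; rewrite mulr_ge0// opp_weight_ge0.
Qed.

End Weights.

(** Survival probability of a child, and below it the mean number of surviving children. Neither
    depends on the spin or on [L], so the laws to be compared have equal masses. *)
Definition kept_mass (kap : R) : R :=
  (expR (- grandchild_mass) * (expR grandchild_mass - grandchild_mass +
    (a / 2 + kap * (b / 2 * (1 - dl)))))%R.

Definition child_mass : R :=
  (a / 2 * kept_mass 1 + b / 2 * kept_mass (expR (- dead_rate)))%R.

(** At the empty list: the probability that no child survives minus the probability [dl] that there
    was none, a case that [live_law] counts separately. *)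
Definition next_law L s : T -> R := node_weight (fun l =>
  if nilp l then expR (- child_mass) - dl
  else expR (- child_mass) * pweight (child_weight L s) l)%R.

Section Step.
Variables (d : nat) (L : bool -> T -> R).
Hypothesis L0 : forall s o, (0 <= L s o)%R.
Hypothesis LP : live_law d.+1 L.

Let a20 : (0 <= a / 2)%R. Proof. by rewrite divr_ge0// ltW. Qed.
Let b20 : (0 <= b / 2)%R. Proof. by rewrite divr_ge0// ltW. Qed.

Definition mark x (w : tree bool) : option (bool * T) :=
  if dead_opposite x w then None
  else Some (root_label w == x, observe d.+1 (adversary d.+1 w)).

Definition mark_iso (y y' : bool * T) : Prop := y.1 = y'.1 /\ tree_iso y.2 y'.2.

Lemma eq_wsum_root x (F G : tree bool -> \bar R) n :
  (forall t, root_label t = x -> F t = G t) ->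
  wsum (broadcast_pmf a b n x) F = wsum (broadcast_pmf a b n x) G.
Proof.
move=> FG; apply: eq_esum => t _; have [/FG -> //|tx] := eqVneq (root_label t) x.
by rewrite broadcast_pmf_root// !mul0e.
Qed.

Lemma wsum_mixture x n (F : tree bool -> \bar R) : (forall t, 0 <= F t) ->
  wsum (fun c => a / 2 * broadcast_pmf a b n x c +
                 b / 2 * broadcast_pmf a b n (~~ x) c)%R F =
  (a / 2)%:E * wsum (broadcast_pmf a b n x) F +
  (b / 2)%:E * wsum (broadcast_pmf a b n (~~ x)) F.
Proof.
move=> F0; rewrite wsumDw//; last 2 first.
- by move=> c; rewrite mulr_ge0// broadcast_pmf_ge0.
- by move=> c; rewrite mulr_ge0// broadcast_pmf_ge0.
by rewrite !wsumZw// => c; exact: broadcast_pmf_ge0.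
Qed.

(** Own-spin children are never erased, so both parts of [live_law] remain; an opposite-spin child
    counts only when it has a child, which the boolean flag of [live_law] records. *)
Lemma wsum_mark x (f : bool * T -> \bar R) : (forall y, 0 <= f y) ->
  (forall y y', mark_iso y y' -> f y = f y') ->
  wsum (fun c => a / 2 * broadcast_pmf a b d.+1 x c +
                 b / 2 * broadcast_pmf a b d.+1 (~~ x) c)%R
    (fun w => if mark x w is Some y then f y else 0) = wsum (mark_weight L x) f.
Proof.
move=> f0 fe; rewrite wsum_mixture; last by move=> w; case: (mark x w).
rewrite wsum_prod_bool//; last exact: mark_weight_ge0.
congr (_ + _).
  rewrite [RHS]wsum_own_weight//; congr (_ * _).
  rewrite (@eq_wsum_root _ _ (fun w => f (true, observe d.+1 (adversary d.+1 w)))).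
    by rewrite (LP x (F := fun _ o => f (true, o)))// => c o o' oo; exact: fe.
  by move=> w wx; rewrite /mark /dead_opposite wx eqxx; case: x {wx}.
rewrite [RHS]wsum_opp_weight//; congr (_ * _).
rewrite (@eq_wsum_root _ _ (fun w => (fun c o => if c then f (false, o) else 0)
  (~~ childless w) (observe d.+1 (adversary d.+1 w)))).
  rewrite (LP (~~ x) (F := fun c o => if c then f (false, o) else 0)).
  - by rewrite mule0 adde0.
  - by case.
  - by case=> // o o' oo; exact: fe.
by move=> w wx; rewrite /mark /dead_opposite wx eqxx/=; case: childless => //=;
  case: x {wx}.
Qed.

Lemma wsum_mark_deleted x :
  wsum (fun c => a / 2 * broadcast_pmf a b d.+1 x c +
                 b / 2 * broadcast_pmf a b d.+1 (~~ x) c)%R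
    (fun w => if mark x w is Some _ then 0 else 1) = dead_rate%:E.
Proof.
rewrite wsum_mixture; last by move=> w; case: (mark x w).
rewrite (@eq_wsum_root _ _ (fun=> 0)); last first.
  by move=> w wx; rewrite /mark /dead_opposite wx; case: x {wx}.
rewrite {1}/wsum esum1 ?mule0 ?add0e; last by move=> *; rewrite mule0.
rewrite (@eq_wsum_root _ _ (fun w => (fun c o => if c then 0 else 1)
  (~~ childless w) (observe d.+1 (adversary d.+1 w)))).
  rewrite (LP (~~ x) (F := fun c o => if c then 0 else 1))//; last by case.
  by rewrite /wsum esum1 ?add0e ?mule1 -?EFinM// => *; rewrite mule0.
by move=> w wx; rewrite /mark /dead_opposite wx eqxx/=; case: childless.
Qed.

(** The part of the cutting condition that the marks of the remaining grandchildren determine. *)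
Definition single_opposite (l : seq (bool * T)) :=
  (size l == 1%N) && all (fun y => ~~ y.1) l.

Lemma cut_edge_mark s x l : cut_edge s (Node x l) =
  [&& x == ~~ s, (0 < count (fun w => ~~ isSome (mark x w)) l)%N &
      single_opposite (pmap (mark x) l)].
Proof.
rewrite /cut_edge; congr [&& _, _ & _].
  rewrite has_count; congr (0 < _)%N; apply: eq_count => w.
  by rewrite /mark; case: ifP.
have -> : pmap (mark x) l = [seq (root_label w == x,
    observe d.+1 (adversary d.+1 w)) | w <- l & ~~ dead_opposite x w].
  by elim: l => //= w l ->; rewrite {1}/mark; case: ifP.
case: [seq w <- l | ~~ dead_opposite x w] => [|w [|w' l']] //=.
by rewrite /single_opposite/= andbT; case: (root_label w); case: x.
Qed.

Lemma observed_childE s x l : observed_child d.+1 s (Node x l) =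
  if cut_edge s (Node x l) then None
  else Some (Node None (map snd (pmap (mark x) l))).
Proof.
rewrite /observed_child; case: ifP => // _; rewrite map_pmap.
congr (Some (Node _ _)); apply: eq_pmap => w.
by rewrite /observed_grandchild /mark; case: ifP.
Qed.

(** Thinning makes the number of erased children independent of the remaining ones. A child opposite
    to [s] whose only remaining child is opposite to it thus survives with the probability
    [expR (- dead_rate)] that nothing was erased; no other configuration is affected. *)
Lemma wsum_observed_child s x (f : T -> \bar R) : (forall o, 0 <= f o) ->
  (forall o o', tree_iso o o' -> f o = f o') ->
  wsum (broadcast_pmf a b d.+2 x)
    (fun v => if observed_child d.+1 s v is Some o then f o else 0) =
  wsum (kept_weight (if x == s then 1%R else expR (- dead_rate)) L x) f.
Proof.
move=> f0 fi.
pose G (j : nat) l := if [&& x == ~~ s, (0 < j)%N & single_opposite l] then 0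
  else f (Node None (map snd l)).
have G0 j l : 0 <= G j l by rewrite /G; case: ifP.
have FG l : (if observed_child d.+1 s (Node x l) is Some o then f o else 0) =
    G (count (fun w => ~~ isSome (mark x w)) l) (pmap (mark x) l).
  by rewrite observed_childE cut_edge_mark /G; case: ifP.
have Gp j l l' : perm_eq l l' -> G j l = G j l'.
  move=> ll; rewrite /G /single_opposite (perm_size ll) (perm_all _ ll).
  by case: ifP => // _; apply: tree_iso_invariant_perm => //; exact: perm_map.
rewrite wsum_broadcast_sym//; last 2 first.
  by move=> v; case: observed_child.
  move=> l l' ll; rewrite !FG (permP ll _) (Gp _ _ (pmap (mark x) l'))//.
  exact: perm_pmap.
rewrite [X in poisum _ X](_ : _ = fun l =>
    G (count (fun w => ~~ isSome (mark x w)) l) (pmap (mark x) l)); last first.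
  by apply/funext => l; exact: FG.
rewrite (@poisum_thin _ _ _ _ (mark_weight L x) (mark x) mark_iso dead_rate)//;
  first last.
- move=> j l1 y y' l2 [y1 y2]; rewrite /G /single_opposite !size_cat !all_cat/= y1.
  by case: ifP => // _; rewrite !map_cat/=; apply: fi; exact: tree_iso_child.
- exact: wsum_mark_deleted.
- exact: wsum_mark.
- exact: mark_weight_ge0.
- by move=> c; rewrite addr_ge0// mulr_ge0// broadcast_pmf_ge0.
(* [N] collects the cases where the number of remaining children is not 1, [A] a single one of spin
   [x], [B] a single opposite one, the only case that a cut can remove. *)
set N := poisum (grandchild_weight L x)
  (fun l => if size l == 1%N then 0 else f (Node None l)).
set A := wsum (own_weight L x) (fun o => f (Node None [:: o])).
set B := wsum (opp_weight L x) (fun o => f (Node None [:: o])).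
have N0 : 0 <= N.
  by apply: poisum_ge0 => [x'|l]; [exact: grandchild_weight_ge0|case: ifP].
have A0 : 0 <= A by apply: wsum_ge0 => // o; exact: own_weight_ge0.
have B0 : 0 <= B by apply: wsum_ge0 => // o; exact: opp_weight_ge0.
have PG j : poisum (mark_weight L x) (G j) =
    (N + A) + (if (x == ~~ s) && (0 < j)%N then 0 else B).
  rewrite (_ : G j = (fun l => (if size (map snd l) == 1%N then 0
      else f (Node None (map snd l))) +
      (if size l == 1%N then G j l else 0))); last first.
    apply/funext => l; rewrite size_map; case: ifP => l1; rewrite ?add0e// adde0.
    by rewrite /G /single_opposite l1 !andbF.
  rewrite poisumD//; last 3 first.
  - exact: mark_weight_ge0.
  - by move=> l; case: ifP.
  - by move=> l; case: ifP.
  rewrite -addeA; congr (_ + _).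
    rewrite (@poisum_map_snd _ _ _ (fun l => if size l == 1%N then 0
      else f (Node None l)))//; last by move=> l; case: ifP.
    exact: mark_weight_ge0.
  rewrite poisum_size1; last 3 first.
  - exact: mark_weight_ge0.
  - by move=> l; case: ifP.
  - by move=> l /negbTE ->.
  rewrite /= wsum_prod_bool//; last exact: mark_weight_ge0.
  congr (_ + _).
    by apply: eq_wsum => o; rewrite /G /single_opposite/= !andbF.
  rewrite /G /single_opposite/= andbT; case: ifP => // _.
  by rewrite /wsum esum1// => o _; rewrite mule0.
rewrite wsum_kept_weight//; last by case: ifP => // _; exact: expR_ge0.
rewrite -/N -/A -/B addeA.
have r0 := dead_rate_ge0.
under eq_esum do rewrite PG.
(* The sum over the number of erased children contributes [expR dead_rate], which turns [dl] into
   the normalisation of [kept_weight]. *)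
have E0 : (dl * expR dead_rate)%R = expR (- grandchild_mass).
  by rewrite -expRD /grandchild_mass; congr expR; ring.
have [->|xs] := eqVneq x s.
  have -> : (s == ~~ s) = false by case: (s).
  by rewrite /= esum_expR_mul ?adde_ge0// muleA -EFinM E0 mul1e.
have -> : x == ~~ s by case: (x) (s) xs => -[].
rewrite (@eq_esum _ _ _ _ (fun j => (j`!%:R^-1 * dead_rate ^+ j)%:E *
    (if (0 < j)%N then N + A else N + A + B))); last first.
  by move=> j _ /=; case: ifP; rewrite ?adde0.
have NA0 : 0 <= N + A by rewrite adde_ge0.
have er1 : (0 <= expR dead_rate - 1)%R by rewrite subr_ge0 -[leLHS]expR0 ler_expR.
rewrite esum_expR_head//; last by rewrite adde_ge0.
rewrite -E0 EFinM -muleA; congr (_ * _).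
rewrite [RHS]ge0_muleDr//; last by rewrite mule_ge0// lee_fin expR_ge0.
rewrite [in RHS]muleA -EFinM -expRD subrr expR0 mul1e addeAC; congr (_ + _).
rewrite -{1}[N + A]mul1e -ge0_muleDl ?lee_fin//.
by rewrite -EFinD addrC subrK.
Qed.
Lemma live_law_mass s : wsum (L s) (fun=> 1) = (1 - dl)%:E.
Proof.
have := broadcast_mass d.+1 s a0 b0; rewrite (LP s (F := fun _ _ => 1))//.
by rewrite mule1 addeC => /adde_EFin_inj.
Qed.

Lemma own_weight_mass x : wsum (own_weight L x) (fun=> 1) = (a / 2)%:E.
Proof.
by rewrite wsum_own_weight// live_law_mass mule1 -EFinD subrK mule1.
Qed.

Lemma opp_weight_mass x : wsum (opp_weight L x) (fun=> 1) = (b / 2 * (1 - dl))%:E.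
Proof. by rewrite wsum_opp_weight// live_law_mass EFinM. Qed.

Lemma grandchild_weight_mass x :
  wsum (grandchild_weight L x) (fun=> 1) = grandchild_mass%:E.
Proof.
rewrite wsumDw//; [|exact: own_weight_ge0|exact: opp_weight_ge0].
rewrite own_weight_mass opp_weight_mass -EFinD; congr EFin.
by rewrite /grandchild_mass /dead_rate; ring.
Qed.

Lemma kept_weight_mass (kap : R) x : (0 <= kap)%R ->
  wsum (kept_weight kap L x) (fun=> 1) = (kept_mass kap)%:E.
Proof.
move=> k0; rewrite wsum_kept_weight// own_weight_mass opp_weight_mass.
have Q0 := grandchild_weight_ge0 L0 x.
rewrite (_ : (fun l => _) = fun l => if size l != 1%N then 1 else 0); last first.
  by apply/funext => l; case: eqP.
rewrite (poisum_size_ne1 Q0 (grandchild_weight_mass x)).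
by rewrite /kept_mass [in RHS]EFinM (EFinD (expR _ - _)) (EFinD (a / 2)) (EFinM kap).
Qed.

Lemma child_weight_mass s : wsum (child_weight L s) (fun=> 1) = child_mass%:E.
Proof.
have k0 := expR_ge0 (- dead_rate).
rewrite wsumDw//; last 2 first.
- by move=> o; rewrite mulr_ge0// kept_weight_ge0.
- by move=> o; rewrite mulr_ge0// kept_weight_ge0.
rewrite (wsumZw a20)// ?(wsumZw b20)//;
  [|by move=> o; rewrite kept_weight_ge0..].
by rewrite !kept_weight_mass.
Qed.

Lemma wsum_child s (f : T -> \bar R) : (forall o, 0 <= f o) ->
  (forall o o', tree_iso o o' -> f o = f o') ->
  wsum (fun c => a / 2 * broadcast_pmf a b d.+2 s c +
                 b / 2 * broadcast_pmf a b d.+2 (~~ s) c)%R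
    (fun v => if observed_child d.+1 s v is Some o then f o else 0) =
  wsum (child_weight L s) f.
Proof.
move=> f0 fi; have k0 := expR_ge0 (- dead_rate).
rewrite wsum_mixture; last by move=> v; case: observed_child.
rewrite !wsum_observed_child// eqxx (_ : (~~ s == s) = false); last by case: s.
rewrite wsumDw//; last 2 first.
- by move=> o; rewrite mulr_ge0// kept_weight_ge0.
- by move=> o; rewrite mulr_ge0// kept_weight_ge0.
rewrite (wsumZw a20)// ?(wsumZw b20)// => o; exact: kept_weight_ge0.
Qed.

(** By complement: kept and deleted children together have mass [a / 2 + b / 2]. *)
Lemma wsum_child_deleted s :
  wsum (fun c => a / 2 * broadcast_pmf a b d.+2 s c +
                 b / 2 * broadcast_pmf a b d.+2 (~~ s) c)%R
    (fun v => if observed_child d.+1 s v is Some _ then 0 else 1) =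
  (a / 2 + b / 2 - child_mass)%:E.
Proof.
apply: adde_EFin_inj; rewrite -(child_weight_mass s) -wsum_child//.
rewrite -wsumD; last 3 first.
- by move=> c; rewrite addr_ge0// mulr_ge0// broadcast_pmf_ge0.
- by move=> v; case: observed_child.
- by move=> v; case: observed_child.
transitivity (wsum (fun c => a / 2 * broadcast_pmf a b d.+2 s c +
                 b / 2 * broadcast_pmf a b d.+2 (~~ s) c)%R (fun=> 1)).
  by apply: eq_wsum => v; case: observed_child; rewrite ?adde0 ?add0e.
by rewrite wsum_mixture// !broadcast_mass// !mule1.
Qed.

Lemma child_mass_le : (child_mass <= a / 2 + b / 2)%R.
Proof.
rewrite -subr_ge0 -lee_fin -(wsum_child_deleted true); apply: wsum_ge0.
  by move=> c; rewrite addr_ge0// mulr_ge0// broadcast_pmf_ge0.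
by move=> v; case: observed_child.
Qed.

Lemma next_law_ge0 s o : (0 <= next_law L s o)%R.
Proof.
rewrite /next_law; case: o => [[y|] l] //=; case: ifP => _.
  by rewrite subr_ge0 ler_expR lerN2 child_mass_le.
by rewrite mulr_ge0 ?expR_ge0// pweight_ge0// => o; exact: child_weight_ge0.
Qed.

(** Thinning at the root of the block. The flag is read in the precursor tree, so with no surviving
    child it is still true when some child was cut off. *)
Lemma live_law_step : live_law d.+3 (next_law L).
Proof.
move=> s F F0 Fi.
pose G (j : nat) l := F ((0 < j)%N || ~~ nilp l) (Node None l).
have rem0 : (0 <= a / 2 + b / 2 - child_mass)%R by rewrite subr_ge0 child_mass_le.
have FG l : F (~~ childless (Node s l)) (observe d.+3 (adversary d.+3 (Node s l))) =
    G (count (fun v => ~~ isSome (observed_child d.+1 s v)) l)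
      (pmap (observed_child d.+1 s) l).
  rewrite observe_adversary /G; congr F => /=.
  elim: l => //= v l IH; case: (observed_child d.+1 s v) => //= o.
  by rewrite orbT.
have Gp j l l' : perm_eq l l' -> G j l = G j l'.
  move=> ll; rewrite /G /nilp (perm_size ll).
  by apply: tree_iso_invariant_perm => //; exact: Fi.
have C0 := child_weight_ge0 L0 s.
rewrite wsum_broadcast_sym//; last first.
  move=> l l' ll; rewrite !FG (permP ll _) (Gp _ _ (pmap (observed_child d.+1 s) l'))//.
  exact: perm_pmap.
rewrite [X in poisum _ X](_ : _ = fun l =>
    G (count (fun v => ~~ isSome (observed_child d.+1 s v)) l)
      (pmap (observed_child d.+1 s) l)); last first.
  by apply/funext => l; exact: FG.
rewrite (@poisum_thin _ _ _ _ (child_weight L s) (observed_child d.+1 s)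
  (@tree_iso _) (a / 2 + b / 2 - child_mass)%R)//; first last.
- move=> j l1 y y' l2 yy; rewrite /G /nilp !size_cat/=.
  by apply: Fi; exact: tree_iso_child.
- by move=> j l; exact: F0.
- exact: wsum_child_deleted.
- exact: wsum_child.
- by move=> c; rewrite addr_ge0// mulr_ge0// broadcast_pmf_ge0.
set P := poisum (child_weight L s)
  (fun l => if nilp l then 0 else F true (Node None l)).
have P0 : 0 <= P by apply: poisum_ge0 => // l; case: ifP.
have PG j : poisum (child_weight L s) (G j) =
    if (0 < j)%N then F true empty + P else F false empty + P.
  rewrite poisum_nil//; last by move=> l; exact: F0.
  rewrite /G /= orbF (_ : poisum _ _ = P); first by case: ifP.
  by congr poisum; apply/funext => l; case: ifP => // ->; rewrite orbT.
under eq_esum do rewrite PG.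
rewrite esum_expR_head ?adde_ge0//.
have e0 := expR_ge0 (- child_mass).
have ed0 : (0 <= expR (- child_mass) - dl)%R.
  by rewrite subr_ge0 ler_expR lerN2 child_mass_le.
have -> : wsum (next_law L s) (F true) =
    (expR (- child_mass) - dl)%:E * F true empty + (expR (- child_mass))%:E * P.
  rewrite wsum_node_weight//; last first.
    by move=> l; case: ifP => // _; rewrite mulr_ge0// pweight_ge0.
  rewrite /P poisumE//; last by move=> l; case: ifP.
  rewrite -esumZ//; last first.
    by move=> l; rewrite mule_ge0 ?lee_fin ?pweight_ge0//; case: ifP.
  rewrite (esumID [set [::]]); last first.
    move=> l _; rewrite mule_ge0//; case: ifP => _; rewrite lee_fin//.
    by rewrite mulr_ge0// pweight_ge0.
  rewrite !setTI esum_set1/=; last by rewrite mule_ge0.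
  congr (_ + _); rewrite [RHS](@esum_restrict _ _ (~` [set [::]])).
    by apply: eq_esum => -[|c l] //= _; rewrite EFinM muleA.
  by move=> l /contrapT ->; rewrite /= !mule0.
have E : (dl * expR (a / 2 + b / 2 - child_mass) = expR (- child_mass))%R.
  by rewrite -expRD; congr expR; ring.
have dl0 := expR_ge0 (- (a / 2 + b / 2)).
have er0 : (0 <= expR (a / 2 + b / 2 - child_mass) - 1)%R.
  by rewrite subr_ge0 -[leLHS]expR0 ler_expR.
set er := expR (a / 2 + b / 2 - child_mass) in E er0 *.
rewrite ge0_muleDr ?mule_ge0 ?adde_ge0//.
rewrite !ge0_muleDr ?mule_ge0 ?adde_ge0// !muleA -!EFinM mulrBr mulr1 E.
rewrite (addeC (dl%:E * F false empty)) -addeA addeCA [RHS]addeC.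
congr (_ + _).
rewrite addeCA; congr (_ + _).
by rewrite -ge0_muleDl ?lee_fin// -EFinD addrC subrK.
Qed.

End Step.
End Block.

(** * Contraction of the Hellinger distance *)

Section Hellinger.
Context {R : realType}.
Implicit Types x y c : R.

Definition hellinger2 x y : R := (Num.sqrt x - Num.sqrt y) ^+ 2.

Lemma hellinger2_ge0 x y : 0 <= hellinger2 x y. Proof. exact: sqr_ge0. Qed.

Lemma hellinger2xx x : hellinger2 x x = 0.
Proof. by rewrite /hellinger2 subrr expr0n. Qed.

Lemma hellinger2M c x y : 0 <= c ->
  hellinger2 (c * x) (c * y) = c * hellinger2 x y.
Proof.
move=> c0; rewrite /hellinger2 !sqrtrM// -mulrBr exprMn sqr_sqrtr//.
Qed.

Lemma hellinger2_affinity x y : 0 <= x -> 0 <= y ->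
  hellinger2 x y + 2 * Num.sqrt (x * y) = x + y.
Proof.
move=> x0 y0; rewrite /hellinger2 sqrtrM//.
rewrite -[in RHS](sqr_sqrtr x0) -[in RHS](sqr_sqrtr y0); ring.
Qed.

Lemma hellinger2_le x y : 0 <= x -> 0 <= y -> hellinger2 x y <= x + y.
Proof.
move=> x0 y0; rewrite -(hellinger2_affinity x0 y0) lerDl.
by rewrite mulr_ge0 ?sqrtr_ge0.
Qed.

(* AM-GM: [n (p + q) <= c n^2 / 2 + (p + q)^2 / (2 c)] with [n = |p - q|]. *)
Lemma dist_sqr_le (p q c : R) : 0 <= p -> 0 <= q -> 0 < c ->
  `|p ^+ 2 - q ^+ 2| <= c / 2 * (p - q) ^+ 2 + c^-1 * (p ^+ 2 + q ^+ 2).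
Proof.
move=> p0 q0 c0.
rewrite subr_sqr normrM (ger0_norm (addr_ge0 p0 q0)).
rewrite -[in leRHS](@real_normK _ (p - q)) ?num_real//.
set n := `|p - q|.
have : 0 <= c / 2 * (n - c^-1 * (p + q)) ^+ 2 + c^-1 / 2 * (p - q) ^+ 2.
  by rewrite addr_ge0// mulr_ge0 ?sqr_ge0// divr_ge0// ?invr_ge0 ltW.
have -> : c / 2 * (n - c^-1 * (p + q)) ^+ 2 + c^-1 / 2 * (p - q) ^+ 2 =
    c / 2 * n ^+ 2 + c^-1 * (p ^+ 2 + q ^+ 2) - n * (p + q).
  by field; rewrite gt_eqF.
by rewrite subr_ge0.
Qed.

Lemma dist_hellinger2 x y c : 0 <= x -> 0 <= y -> 0 < c ->
  `|x - y| <= c / 2 * hellinger2 x y + c^-1 * (x + y).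
Proof.
move=> x0 y0 c0; have := dist_sqr_le (sqrtr_ge0 x) (sqrtr_ge0 y) c0.
by rewrite !sqr_sqrtr.
Qed.

(** [P^2 - Q^2 = (A - B) (p^2 - q^2)], so it suffices that [(P + Q)^2 >= (A + B) (p + q)^2]. This
    follows from [P Q >= (A + B) p q], where the squares differ by [A B (p^2 - q^2)^2] plus
    nonnegative terms in [c]. *)
Lemma sqr_mix_le (A B c p q P Q : R) : 0 <= A -> 0 <= B -> 0 < A + B ->
  0 <= c -> 0 <= p -> 0 <= q -> 0 <= P -> 0 <= Q ->
  P ^+ 2 = A * p ^+ 2 + B * q ^+ 2 + c ->
  Q ^+ 2 = B * p ^+ 2 + A * q ^+ 2 + c ->
  (P - Q) ^+ 2 <= (A - B) ^+ 2 / (A + B) * (p - q) ^+ 2.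
Proof.
move=> A0 B0 AB0 c0 p0 q0 P0 Q0 P2 Q2.
have [pq0|pq0] := eqVneq (p + q) 0.
  have [p00 q00] : p = 0 /\ q = 0 by move: pq0 p0 q0; lra.
  have -> : P = Q.
    by apply/eqP; rewrite -(@eqrXn2 _ 2)// P2 Q2 p00 q00; apply/eqP; ring.
  by rewrite p00 q00 !subrr expr0n mulr0.
have pq1 : 0 < (p + q) ^+ 2 by rewrite exprn_gt0// lt_def pq0 addr_ge0.
rewrite mulrAC ler_pdivlMr// -(ler_pM2r pq1).
have PQ : (A + B) * (p * q) <= P * Q.
  rewrite -ler_sqr ?nnegrE ?mulr_ge0 ?(ltW AB0)//.
  rewrite [(P * Q) ^+ 2]exprMn P2 Q2.
  have -> : (A * p ^+ 2 + B * q ^+ 2 + c) * (B * p ^+ 2 + A * q ^+ 2 + c) =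
    ((A + B) * (p * q)) ^+ 2 + (A * B * (p ^+ 2 - q ^+ 2) ^+ 2 +
    c * ((A + B) * p ^+ 2 + (A + B) * q ^+ 2 + c)) by ring.
  have AB1 := ltW AB0.
  have h1 : 0 <= A * B * (p ^+ 2 - q ^+ 2) ^+ 2.
    by rewrite mulr_ge0 ?sqr_ge0// mulr_ge0.
  have h2 : 0 <= c * ((A + B) * p ^+ 2 + (A + B) * q ^+ 2 + c).
    by rewrite mulr_ge0// !addr_ge0// mulr_ge0 ?sqr_ge0.
  by rewrite lerDl addr_ge0.
have H1 : (A + B) * (p + q) ^+ 2 <= (P + Q) ^+ 2.
  rewrite !sqrrD P2 Q2 -subr_ge0.
  have -> : A * p ^+ 2 + B * q ^+ 2 + c + P * Q *+ 2 +
     (B * p ^+ 2 + A * q ^+ 2 + c) - (A + B) * (p ^+ 2 + p * q *+ 2 + q ^+ 2) =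
     2 * c + 2 * (P * Q - (A + B) * (p * q)) by ring.
  by rewrite addr_ge0 ?mulr_ge0 ?subr_ge0.
rewrite -mulrA (le_trans (ler_wpM2l (sqr_ge0 (P - Q)) H1))//.
rewrite -exprMn -subr_sqr P2 Q2 le_eqVlt; apply/orP; left; apply/eqP; ring.
Qed.

(** A symmetric channel with rates [A] and [B] contracts; [c] is a contribution common to both
    spins, later that of childless vertices. *)
Lemma hellinger2_mix (A B c x y : R) : 0 <= A -> 0 <= B -> 0 < A + B ->
  0 <= c -> 0 <= x -> 0 <= y ->
  hellinger2 (A * x + B * y + c) (B * x + A * y + c) <=
  (A - B) ^+ 2 / (A + B) * hellinger2 x y.
Proof.
move=> A0 B0 AB0 c0 x0 y0.
have X0 : 0 <= A * x + B * y + c by rewrite !addr_ge0// mulr_ge0.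
have Y0 : 0 <= B * x + A * y + c by rewrite !addr_ge0// mulr_ge0.
by apply: (@sqr_mix_le _ _ c) => //; rewrite ?sqrtr_ge0// !sqr_sqrtr.
Qed.

Local Open Scope ereal_scope.

(** The integrand of the Hellinger affinity, or Bhattacharyya coefficient. *)
Definition affinity (T : Type) (f g : T -> R) (o : T) : R := Num.sqrt (f o * g o)%R.

(** Geometric means commute with products, so the affinity of two Poisson processes is again a
    Poisson sum, of intensity [affinity f g]. *)
Lemma pweight_affinity (T : choiceType) (f g : T -> R) (l : seq T) :
  (forall o, (0 <= f o)%R) -> (forall o, (0 <= g o)%R) ->
  pweight (affinity f g) l = affinity (pweight f) (pweight g) l.
Proof.
move=> f0 g0; rewrite /affinity /pweight.
have n0 : (0 <= ((size l)`!%:R^-1 : R))%R by rewrite invr_ge0.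
rewrite mulrACA -expr2 sqrtrM ?sqr_ge0// sqrtr_sqr ger0_norm//; congr (_ * _)%R.
rewrite -big_split/=; elim: l {n0} => [|o l IH]; first by rewrite !big_nil sqrtr1.
by rewrite !big_cons IH [in RHS]sqrtrM ?mulr_ge0.
Qed.

(** Summing [x + y = hellinger2 x y + 2 sqrt (x y)] reduces a Hellinger sum to three masses; [P]
    singles out a part of the space. *)
Lemma esum_hellinger2 (T : choiceType) (P : pred T) (f g : T -> R) (c c' : R) :
  (forall o, (0 <= f o)%R) -> (forall o, (0 <= g o)%R) ->
  wsum f (fun o => if P o then 1 else 0) = c%:E ->
  wsum g (fun o => if P o then 1 else 0) = c%:E ->
  wsum (affinity f g) (fun o => if P o then 1 else 0) = c'%:E ->
  \esum_(o in [set: T]) (if P o then hellinger2 (f o) (g o) else 0)%:E =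
  (2 * (c - c'))%:E.
Proof.
move=> f0 g0 fc gc ac; rewrite mulrBr; apply: adde_EFin_inj.
have z0 (o : T) : 0 <= (if P o then 1 else 0 : \bar R) by case: ifP.
have a0 (o : T) : (0 <= affinity f g o)%R by exact: sqrtr_ge0.
rewrite (_ : (2 * c)%:E = c%:E + c%:E); last by rewrite -EFinD mulr_natl.
rewrite EFinM -ac -{1}fc -gc -wsumDw// -wsumZw//.
rewrite -esumD; last 2 first.
  by move=> o _; rewrite mule_ge0// lee_fin mulr_ge0.
  by move=> o _; case: ifP => _; rewrite lee_fin ?hellinger2_ge0.
apply: eq_esum => o _; case: ifP => _; rewrite ?mule0 ?adde0// !mule1 -EFinD.
by rewrite addrC hellinger2_affinity.
Qed.

Lemma hellinger_total (T : choiceType) (f g : T -> R) (m : R) :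
  (forall o, (0 <= f o)%R) -> (forall o, (0 <= g o)%R) ->
  wsum f (fun=> 1) = m%:E -> wsum g (fun=> 1) = m%:E ->
  exists h : R, [/\ (0 <= h)%R,
    \esum_(o in [set: T]) (hellinger2 (f o) (g o))%:E = h%:E &
    wsum (affinity f g) (fun=> 1) = (m - h / 2)%:E].
Proof.
move=> f0 g0 fm gm.
have a0 (o : T) : (0 <= affinity f g o)%R by exact: sqrtr_ge0.
have : wsum (affinity f g) (fun=> 1) <= m%:E + m%:E.
  rewrite -{1}fm -gm -wsumDw//; apply: le_esum => o _; rewrite !mule1 lee_fin.
  rewrite -[leRHS](hellinger2_affinity (f0 o) (g0 o)).
  by rewrite -[leLHS]add0r lerD ?hellinger2_ge0// ler_peMl// ler1n.
have := wsum_ge0 a0 (fun=> lee01); case E : (wsum _ _) => [c'| |] //= c'0 c'm.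
have H := @esum_hellinger2 _ predT _ _ _ _ f0 g0 fm gm E.
exists (2 * (m - c'))%R; split => //.
  by rewrite -lee_fin -H; apply: esum_ge0 => o _; rewrite lee_fin hellinger2_ge0.
by congr EFin; field.
Qed.

Section PoissonHellinger.
Variables (T : choiceType) (f g : T -> R) (m h : R).
Hypotheses (f0 : forall o, (0 <= f o)%R) (g0 : forall o, (0 <= g o)%R).
Hypotheses (fm : wsum f (fun=> 1) = m%:E) (gm : wsum g (fun=> 1) = m%:E).
Hypothesis am : wsum (affinity f g) (fun=> 1) = (m - h / 2)%:E.

Let a0 (o : T) : (0 <= affinity f g o)%R. Proof. exact: sqrtr_ge0. Qed.

Lemma poisson_hellinger_pred (P : pred (seq T)) (c c' : R) :
  poisum f (fun l => if P l then 1 else 0) = c%:E ->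
  poisum g (fun l => if P l then 1 else 0) = c%:E ->
  poisum (affinity f g) (fun l => if P l then 1 else 0) = c'%:E ->
  \esum_(l in [set: seq T])
    (if P l then hellinger2 (pweight f l) (pweight g l) else 0)%:E =
  (2 * (c - c'))%:E.
Proof.
have z0 (l : seq T) : 0 <= (if P l then 1 else 0 : \bar R) by case: ifP.
rewrite !poisumE// => fc gc ac; apply: esum_hellinger2 => //.
- exact: pweight_ge0.
- exact: pweight_ge0.
- rewrite -ac; apply: eq_esum => l _.
  by rewrite pweight_affinity.
Qed.

(** After normalisation by [expR (- m)] this is [2 (1 - expR (- (h / 2)))], at most [h]: processes
    are no further apart than their intensities. *)
Lemma poisson_hellinger :
  \esum_(l in [set: seq T]) (hellinger2 (pweight f l) (pweight g l))%:E =
  (2 * (expR m - expR (m - h / 2)))%:E.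
Proof.
apply: (@poisson_hellinger_pred predT).
- by rewrite (poisum_cst f0 fm lee01) mule1.
- by rewrite (poisum_cst g0 gm lee01) mule1.
- by rewrite (poisum_cst a0 am lee01) mule1.
Qed.

(** One-point lists are left out because the adversary acts there, and another contraction factor
    applies to them. *)
Lemma poisson_hellinger_size_ne1 :
  \esum_(l in [set: seq T]) (if size l != 1%N
    then hellinger2 (pweight f l) (pweight g l) else 0)%:E =
  (2 * (expR m - m - (expR (m - h / 2) - (m - h / 2))))%:E.
Proof.
apply: (@poisson_hellinger_pred (fun l => size l != 1%N)).
- exact: poisum_size_ne1.
- exact: poisum_size_ne1.
- exact: poisum_size_ne1.
Qed.

End PoissonHellinger.
End Hellinger.

Lemma scaled_factor (F : realFieldType) (e x y : F) : 0 < e -> 0 < x + y ->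
  (e * x - e * y) ^+ 2 / (e * x + e * y) = e * ((x - y) ^+ 2 / (x + y)).
Proof. by move=> e0 xy0; rewrite -mulrDr; field; rewrite !gt_eqF. Qed.

(** Last estimate of [child_hellinger], with [c] the edge factor, [e = expR (- gm)] and
    [x = expR (- (q / 2))]. It combines [2 (1 - x) <= q] with [q <= c h]. *)
Lemma factor_le (F : realFieldType) (c e q h x : F) : 0 <= c -> e <= 1 ->
  q <= c * h -> 1 - q / 2 <= x ->
  c * (2 * (1 - x) - e * q) <= c ^+ 2 * (1 - e) * h.
Proof.
move=> c0 e1 qh qx; apply: (@le_trans _ _ (c * ((1 - e) * q))).
  by rewrite ler_wpM2l//; move: qx; lra.
rewrite (_ : c ^+ 2 * _ * h = c * ((1 - e) * (c * h))); last by ring.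
by rewrite !ler_wpM2l// subr_ge0.
Qed.

(** * One block of the adversary as a contraction *)

Section Contraction.
Context {R : realType}.
Variables a b : R.
Hypotheses (a0 : 0 < a) (b0 : 0 < b).
Local Notation T := (tree (option bool)).
Local Notation empty := (Node None [::] : T).
Local Notation dl := (expR (- (a / 2 + b / 2))).
Local Notation gm := (grandchild_mass a b).
Local Notation kap := (expR (- dead_rate a b)).

(** Equal to [k (1 - 2 eps)^2] for [a = 2 k (1 - eps)] and [b = 2 k eps]. *)
Definition edge_factor : R := (a / 2 - b / 2) ^+ 2 / (a / 2 + b / 2).

(** The factor of [hellinger2_mix] for a two-edge path. Equal end spins have rate
    [(a / 2)^2 + kap (b / 2)^2], where the doubly flipped paths are thinned by [kap]; opposite end
    spins have rate [2 (a / 2) (b / 2)]. *)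
Definition path_factor : R :=
  ((a / 2) ^+ 2 + kap * (b / 2) ^+ 2 - 2 * (a / 2) * (b / 2)) ^+ 2 /
  ((a / 2) ^+ 2 + kap * (b / 2) ^+ 2 + 2 * (a / 2) * (b / 2)).

(** [expR (- gm)] is the probability that a grandchild has no observed sibling; only then does the
    thinned path replace two plain edges. *)
Definition block_factor : R :=
  edge_factor ^+ 2 * (1 - expR (- gm)) + expR (- gm) * path_factor.

Let a20 : 0 < a / 2. Proof. by rewrite divr_gt0. Qed.
Let b20 : 0 < b / 2. Proof. by rewrite divr_gt0. Qed.
Let ab0 : 0 < a / 2 + b / 2. Proof. by rewrite addr_gt0. Qed.

Lemma edge_factor_ge0 : 0 <= edge_factor.
Proof. by rewrite divr_ge0 ?sqr_ge0// ltW. Qed.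

Lemma path_factor_den_gt0 :
  0 < (a / 2) ^+ 2 + kap * (b / 2) ^+ 2 + 2 * (a / 2) * (b / 2).
Proof. by rewrite !addr_gt0// ?exprn_gt0// !mulr_gt0 ?expR_gt0. Qed.

Lemma path_factor_ge0 : 0 <= path_factor.
Proof. by rewrite divr_ge0 ?sqr_ge0// ltW// path_factor_den_gt0. Qed.

Lemma grandchild_mass_ge0 : 0 <= gm.
Proof.
rewrite /grandchild_mass /dead_rate -addrA addr_ge0 ?(ltW a20)//.
rewrite -{1}(mulr1 (b / 2)) -mulrBr mulr_ge0 ?(ltW b20)// subr_ge0.
by rewrite -[leRHS]expR0 ler_expR oppr_le0 ltW.
Qed.

Lemma block_factor_ge0 : 0 <= block_factor.
Proof.
rewrite addr_ge0// mulr_ge0 ?expR_ge0 ?path_factor_ge0 ?sqr_ge0//.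
by rewrite subr_ge0 -expR0 ler_expR oppr_le0 grandchild_mass_ge0.
Qed.

Local Open Scope ereal_scope.

Lemma esum_Node_None (F : T -> \bar R) : (forall o, 0 <= F o) ->
  (forall y l, F (Node (Some y) l) = 0) ->
  \esum_(o in [set: T]) F o = \esum_(l in [set: seq T]) F (Node None l).
Proof.
move=> F0 FS; rewrite esum_tree// (@esum_single _ _ None)//; first exact: esum_ge0.
by case=> // y _; rewrite esum1.
Qed.

Definition hellinger (f : bool -> T -> R) : \bar R :=
  \esum_(o in [set: T]) (hellinger2 (f true o) (f false o))%:E.

Section Step.
Variables (d : nat) (L : bool -> T -> R).
Hypothesis L0 : forall s o, (0 <= L s o)%R.
Hypothesis LP : live_law a b d.+1 L.
Variable h : R.
Hypothesis Lh : hellinger L = h%:E.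

Lemma grandchild_hellinger :
  hellinger (grandchild_weight a b L) <= (edge_factor * h)%:E.
Proof.
rewrite EFinM -Lh -esumZ ?edge_factor_ge0//; last first.
  by move=> o; rewrite lee_fin hellinger2_ge0.
apply: le_esum => o _; rewrite -EFinM lee_fin.
rewrite /grandchild_weight /own_weight /opp_weight/=.
rewrite (_ : a / 2 * _ + _ = a / 2 * L true o + b / 2 * L false o +
  a / 2 * (dl * (o == empty)%:R))%R; last by ring.
rewrite (_ : a / 2 * (L false o + _) + _ = b / 2 * L true o + a / 2 * L false o +
  a / 2 * (dl * (o == empty)%:R))%R; last by ring.
apply: hellinger2_mix => //; [exact: ltW|exact: ltW|].
by rewrite mulr_ge0 ?(ltW a20)// mulr_ge0 ?expR_ge0.
Qed.

Lemma child_weight_ne1 s l : size l != 1%N ->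
  (child_weight a b L s (Node None l) =
   expR (- gm) * (a / 2 * pweight (grandchild_weight a b L s) l +
                  b / 2 * pweight (grandchild_weight a b L (~~ s)) l))%R.
Proof.
move=> l1; rewrite /child_weight /kept_weight/= /path_weight.
by case: l l1 => [|o [|o' l]] // _; ring.
Qed.

Lemma child_weight1 s o :
  (child_weight a b L s (Node None [:: o]) =
   expR (- gm) * ((a / 2) ^+ 2 + kap * (b / 2) ^+ 2) * L s o +
   expR (- gm) * (2 * (a / 2) * (b / 2)) * L (~~ s) o +
   expR (- gm) * (a / 2 * (a / 2 + b / 2) * (dl * (o == empty)%:R)))%R.
Proof.
rewrite /child_weight /kept_weight/= /own_weight /opp_weight negbK; ring.
Qed.

(** The observation of a child is split by its number of observed children. If this is not 1,
    nothing is thinned and the edge contraction applies before and after the Poisson comparison; if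
    it is 1, the path contraction applies to [L] directly. *)
Lemma child_hellinger :
  hellinger (child_weight a b L) <= (block_factor * h)%:E.
Proof.
have Q0 s := grandchild_weight_ge0 a0 b0 L0 s.
have QM s := grandchild_weight_mass a0 b0 L0 LP s.
have [q [q0 qE qA]] := hellinger_total (Q0 true) (Q0 false) (QM true) (QM false).
have qh : (q <= edge_factor * h)%R by rewrite -lee_fin -qE grandchild_hellinger.
have e0 := expR_ge0 (- gm); have er0 := edge_factor_ge0.
have pf0 := path_factor_ge0.
rewrite /hellinger esum_Node_None; last 2 first.
  by move=> o; rewrite lee_fin hellinger2_ge0.
  by move=> y l; rewrite /child_weight /kept_weight/= !mulr0 addr0 hellinger2xx.
pose f1 l := (if size l != 1%N then hellinger2
  (pweight (grandchild_weight a b L true) l)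
  (pweight (grandchild_weight a b L false) l) else 0)%R.
pose f2 (l : seq T) := (if l is [:: o] then hellinger2 (L true o) (L false o) else 0)%R.
have f10 l : (0 <= f1 l)%R by rewrite /f1; case: ifP; rewrite ?hellinger2_ge0.
have f20 l : (0 <= f2 l)%R.
  by rewrite /f2; case: l => [|o [|o' l]]; rewrite ?hellinger2_ge0.
apply: (@le_trans _ _ (\esum_(l in [set: seq T])
  ((expR (- gm) * edge_factor)%:E * (f1 l)%:E +
   (expR (- gm) * path_factor)%:E * (f2 l)%:E))).
  apply: le_esum => l _; rewrite -!EFinM -EFinD lee_fin.
  have [/eqP l1|l1] := boolP (size l == 1%N).
    rewrite /f1 l1 eqxx mulr0 add0r; case: l l1 => [|o [|o' l]] //= _.
    rewrite !child_weight1 /f2/=.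
    rewrite (addrC (expR (- gm) * ((a / 2) ^+ 2 + _) * L false o)%R).
    apply: le_trans (hellinger2_mix _ _ _ _ _ _) _ => //.
    - by rewrite mulr_ge0// addr_ge0 ?sqr_ge0// mulr_ge0 ?sqr_ge0 ?expR_ge0.
    - by rewrite !mulr_ge0// ltW.
    - by rewrite -mulrDr mulr_gt0 ?expR_gt0// path_factor_den_gt0.
    - by rewrite !mulr_ge0 ?expR_ge0// ltW.
    rewrite le_eqVlt; apply/orP; left; apply/eqP; congr (_ * _)%R.
    exact: scaled_factor (expR_gt0 _) path_factor_den_gt0.
  rewrite /f2 (_ : (if l is [:: o] then _ else _) = 0)%R; last first.
    by case: l l1 => [|o [|o' l]].
  rewrite mulr0 addr0 /f1 l1 !child_weight_ne1// hellinger2M//= -[leRHS]mulrA.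
  rewrite ler_wpM2l// (addrC (a / 2 * pweight (grandchild_weight a b L false) l)%R).
  have p0 s : (0 <= pweight (grandchild_weight a b L s) l)%R by exact: pweight_ge0.
  have := @hellinger2_mix _ (a / 2)%R (b / 2)%R 0%R _ _ (ltW a20) (ltW b20) ab0
    (lexx _) (p0 true) (p0 false).
  by rewrite !addr0.
rewrite esumD; last 2 first.
- by move=> l _; apply: mule_ge0; rewrite lee_fin// mulr_ge0.
- by move=> l _; apply: mule_ge0; rewrite lee_fin// mulr_ge0.
rewrite (esumZ _ (mulr_ge0 e0 er0))// (esumZ _ (mulr_ge0 e0 pf0))//.
rewrite (poisson_hellinger_size_ne1 (Q0 true) (Q0 false) (QM true) (QM false) qA).
have -> : \esum_(l in [set: seq T]) (f2 l)%:E = h%:E.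
  rewrite (@esum_restrict _ _ [set l | size l = 1%N]).
    by rewrite esum_seq1// -Lh.
  by move=> [|x [|x' l]] //= /(_ erefl).
rewrite -2!EFinM -EFinD lee_fin /block_factor [leRHS]mulrDl.
apply: lerD => //.
(* Normalisation turns the Poisson total into [2 (1 - expR (- (q / 2)))], less the share [e q] of
   the one-point lists. *)
set e := expR (- gm).
have eE : (e * expR gm = 1)%R by rewrite -expRD addrC subrr expR0.
have eE2 : (e * expR (gm - q / 2) = expR (- (q / 2)))%R.
  by rewrite -expRD; congr expR; ring.
have e1 : (e <= 1)%R.
  by rewrite -expR0 ler_expR oppr_le0 grandchild_mass_ge0.
have eq : (1 - q / 2 <= expR (- (q / 2)))%R by exact: expR_ge1Dx.
rewrite (_ : _ * (2 * _) = edge_factor * (2 * (e * expR gm - e * expR (gm - q / 2))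
  - e * q))%R; last by field.
by rewrite eE eE2; exact: factor_le.
Qed.

(** The empty list has the same weight under both spins; elsewhere the law is that of a Poisson
    process and is compared through its intensities. *)
Lemma next_hellinger : hellinger (next_law a b L) <= (block_factor * h)%:E.
Proof.
have C0 s := child_weight_ge0 a0 b0 L0 s.
have CM s := child_weight_mass a0 b0 L0 LP s.
have [c [c0 cE cA]] := hellinger_total (C0 true) (C0 false) (CM true) (CM false).
have ch : (c <= block_factor * h)%R by rewrite -lee_fin -cE child_hellinger.
apply: (@le_trans _ _ c%:E); last by rewrite lee_fin.
set m := child_mass a b in CM cA *.
rewrite /hellinger esum_Node_None; last 2 first.
  by move=> o; rewrite lee_fin hellinger2_ge0.
  by move=> y l; rewrite /next_law/= hellinger2xx.
apply: (@le_trans _ _ (\esum_(l in [set: seq T]) ((expR (- m))%:E *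
  (hellinger2 (pweight (child_weight a b L true) l)
              (pweight (child_weight a b L false) l))%:E))).
  apply: le_esum => l _; rewrite -EFinM lee_fin /next_law/=; case: ifP => _.
    by rewrite hellinger2xx mulr_ge0 ?expR_ge0 ?hellinger2_ge0.
  by rewrite hellinger2M ?expR_ge0.
rewrite esumZ ?expR_ge0//; last by move=> l; rewrite lee_fin hellinger2_ge0.
rewrite (poisson_hellinger (C0 true) (C0 false) (CM true) (CM false) cA).
rewrite -EFinM lee_fin.
have E1 : (expR (- m) * expR m = 1)%R by rewrite -expRD addrC subrr expR0.
have E2 : (expR (- m) * expR (m - c / 2) = expR (- (c / 2)))%R.
  by rewrite -expRD; congr expR; ring.
have := expR_ge1Dx (- (c / 2)).
by rewrite mulrCA mulrBr E1 E2; lra.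
Qed.

End Step.
End Contraction.

(** * Impossibility of recovery *)

Section Recovery.
Context {R : realType}.
Variables a b : R.
Hypotheses (a0 : 0 < a) (b0 : 0 < b).
Local Notation T := (tree (option bool)).
Local Notation empty := (Node None [::] : T).
Local Notation dl := (expR (- (a / 2 + b / 2))).
Local Open Scope ereal_scope.

Lemma adversary_nil d s : adversary d (Node s [::]) = Node s [::].
Proof. by case: d => [|[|[|d]]]. Qed.

Lemma broadcast_pmf_nil d s : broadcast_pmf a b d.+1 s (Node s [::]) = dl.
Proof.
rewrite /= !eqxx/= !big_nil /poisson_pmf !divr_gt0// !expr0 !mulr1 !mul1r.
by rewrite -[0`!]/1%N mulr1n invr1 !mul1r -expRD opprD.
Qed.

Local Arguments broadcast_pmf : simpl never.

(** Starting point of the iteration: the image under the observation of the law of trees whose root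
    has a child, with no use of the block structure. *)
Lemma live_law_exists d : exists L : bool -> T -> R,
  (forall s o, (0 <= L s o)%R) /\ live_law a b d.+1 L.
Proof.
pose ob t := observe d.+1 (adversary d.+1 t).
pose A (o : T) := [set t : tree bool | ~~ childless t /\ ob t = o].
(* [fine] loses nothing: the sum is at most the total mass 1. *)
pose L s o := fine (\esum_(t in A o) (broadcast_pmf a b d.+1 s t)%:E).
have p0 s t : 0 <= (broadcast_pmf a b d.+1 s t)%:E by rewrite lee_fin broadcast_pmf_ge0.
have LE s o : (L s o)%:E = \esum_(t in A o) (broadcast_pmf a b d.+1 s t)%:E.
  rewrite /L fineK// ge0_fin_numE; last exact: esum_ge0.
  apply: (@le_lt_trans _ _ 1); last exact: ltry.
  rewrite -(broadcast_mass d.+1 s a0 b0) esum_mkcond; apply: le_esum => t _.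
  by rewrite mule1; case: ifP.
exists L; split.
  by move=> s o; rewrite -lee_fin LE; exact: esum_ge0.
move=> s F F0 Fi; rewrite {1}/wsum.
rewrite (esumID [set t | ~~ childless t]); last by move=> t _; rewrite mule_ge0.
rewrite !setTI; congr (_ + _).
  transitivity (\esum_(o in [set: T]) \esum_(t in A o)
      ((broadcast_pmf a b d.+1 s t)%:E * F true o)); last first.
    apply: eq_esum => o _; rewrite muleC LE -esumZe//.
    by apply: eq_esum => t _; rewrite muleC.
  rewrite esum_esum; last by move=> o t _ _; rewrite mule_ge0.
  rewrite (@reindex_esum _ _ _ [set t : tree bool | ~~ childless t]
    ([set: T] `*`` A) (fun t => (ob t, t))).
    by apply: eq_esum => t /= ->.
  split.
  - by move=> t /= tl.
  - by move=> t t' _ _ [].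
  - by move=> [x t] [_ [/= tl <-]]; exists t.
rewrite (_ : ~` _ = [set t : tree bool | childless t]); last first.
  by apply/seteqP; split => t /=; [move/negP; rewrite negbK|move=> ->].
rewrite -[LHS](@eq_esum _ _ _ (fun t => if childless t then
    (broadcast_pmf a b d.+1 s t)%:E * F false (ob t) else 0)); last first.
  by move=> t /= tl; rewrite tl.
rewrite -(@esum_restrict _ _ [set t : tree bool | childless t]); last first.
  by move=> t /negP/negbTE /= ->.
rewrite (@esum_single _ _ (Node s [::])).
- by rewrite /= broadcast_pmf_nil /ob adversary_nil.
- by rewrite /= mule_ge0.
- move=> [x [|c l]] //= xs; rewrite broadcast_pmf_root ?mul0e//.
  by apply: contraNN xs => /eqP/= ->.
Qed.

Lemma base_hellinger d (L : bool -> T -> R) : (forall s o, (0 <= L s o)%R) -> live_law a b d.+1 L ->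
  hellinger L <= 2%:E.
Proof.
move=> L0 LP.
apply: (@le_trans _ _ (wsum (L true) (fun=> 1) + wsum (L false) (fun=> 1))).
  rewrite -wsumDw//; apply: le_esum => o _; rewrite mule1 lee_fin.
  exact: hellinger2_le.
rewrite !(live_law_mass a0 b0 LP) -EFinD lee_fin.
have := expR_ge0 (- (a / 2 + b / 2)); lra.
Qed.

Lemma live_law_contracting n e : exists L : bool -> T -> R,
  [/\ forall s o, (0 <= L s o)%R, live_law a b (n.*2 + e).+1 L &
      hellinger L <= (2 * block_factor a b ^+ n)%:E].
Proof.
elim: n => [|n [L [L0 LP Lh]]].
  have [L [L0 LP]] := live_law_exists e.
  by exists L; split => //; rewrite mulr1; exact: base_hellinger LP.
exists (next_law a b L); split.
- exact: next_law_ge0 LP.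
- exact: live_law_step LP.
have LM s := live_law_mass a0 b0 LP s.
have [h [h0 hE _]] := hellinger_total (L0 true) (L0 false) (LM true) (LM false).
apply: (le_trans (next_hellinger a0 b0 L0 LP hE)).
rewrite lee_fin exprS mulrCA ler_wpM2l ?block_factor_ge0//.
by rewrite -lee_fin -hE.
Qed.

(** On each observation the estimator collects one of two weights, at most half of their sum plus
    half of their distance, which [dist_hellinger2] bounds for any [c]. Childless trees look alike
    under both spins, so exactly one of the two guesses is right there. *)
Lemma recovery_bound d (L : bool -> T -> R) est (c h : R) :
  (forall s o, (0 <= L s o)%R) -> live_law a b d.+1 L -> root_estimator est ->
  (0 < c)%R -> hellinger L <= h%:E ->
  broadcast_prob a b d.+1
    [set t | est d.+1 (observe d.+1 (adversary d.+1 t)) = root_label t] <=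
  (2^-1 + (c * h / 8 + c^-1 / 2))%:E.
Proof.
move=> L0 LP estP c0 Lh.
pose I (s : bool) (o : T) : \bar R := if est d.+1 o == s then 1 else 0.
have I0 s o : 0 <= I s o by rewrite /I; case: ifP.
have Ii s o o' : tree_iso o o' -> I s o = I s o' by move=> oo; rewrite /I (estP _ o o').
pose ob t := observe d.+1 (adversary d.+1 t).
have p0 s t := broadcast_pmf_ge0 a b d.+1 s t.
have -> : broadcast_prob a b d.+1 [set t | est d.+1 (ob t) = root_label t] =
    (2^-1)%:E * (wsum (broadcast_pmf a b d.+1 true) (fun t => I true (ob t)) +
                 wsum (broadcast_pmf a b d.+1 false) (fun t => I false (ob t))).
  rewrite /broadcast_prob esum_mkcond -esumD; last 2 first.
    by move=> t _; rewrite mule_ge0// lee_fin.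
    by move=> t _; rewrite mule_ge0// lee_fin.
  rewrite -esumZ//; last by move=> t; rewrite adde_ge0// mule_ge0// lee_fin.
  apply: eq_esum => t _; rewrite /I.
  have [tA|tA] := boolP (t \in _).
    move: tA; rewrite inE /= => ->; case E : (root_label t) => /=.
      rewrite (@broadcast_pmf_root _ _ _ _ false) ?E// mule1 mul0e adde0.
      by rewrite -EFinM.
    rewrite (@broadcast_pmf_root _ _ _ _ true) ?E// mule1 mul0e add0e.
    by rewrite -EFinM.
  move: tA; rewrite notin_setE /= => /eqP; case E : (root_label t).
    rewrite (@broadcast_pmf_root _ _ _ _ false) ?E// mul0e adde0.
    by move=> /negbTE ->; rewrite !mule0.
  rewrite (@broadcast_pmf_root _ _ _ _ true) ?E// mul0e add0e.
  by move=> /negbTE ->; rewrite !mule0.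
have LI s : wsum (broadcast_pmf a b d.+1 s) (fun t => I s (ob t)) =
    wsum (L s) (I s) + dl%:E * I s empty 
  by exact: (LP s (fun _ => I s) (fun _ => I0 s) (fun _ => Ii s)).
rewrite !LI.
have D0 := expR_ge0 (- (a / 2 + b / 2)).
rewrite addeACA -ge0_muleDr// (_ : I true empty + I false empty = 1); last first.
  by rewrite /I; case: (est _ _); rewrite ?adde0 ?add0e.
have LM s := live_law_mass a0 b0 LP s.
have i0 : (0 < c^-1)%R by rewrite invr_gt0.
have key : wsum (L true) (I true) + wsum (L false) (I false) <=
    (1 - dl + (c * h / 4 + c^-1))%:E.
  apply: (@le_trans _ _ (\esum_(o in [set: T])
    ((2^-1 + c^-1 / 2)%:E * ((L true o)%:E + (L false o)%:E) +
     (c / 4)%:E * (hellinger2 (L true o) (L false o))%:E))).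
    rewrite -esumD; last 2 first.
      by move=> o _; rewrite mule_ge0// lee_fin.
      by move=> o _; rewrite mule_ge0// lee_fin.
    apply: le_esum => o _.
    have := dist_hellinger2 (L0 true o) (L0 false o) c0.
    rewrite ler_norml => /andP[h1 h2].
    rewrite -[leRHS]/((2^-1 + c^-1 / 2) * (L true o + L false o) +
      c / 4 * hellinger2 (L true o) (L false o))%:E.
    rewrite /I; case: (est _ o) => /=;
      rewrite mule1 mule0 ?adde0 ?add0e lee_fin.
      move: h2; move: (hellinger2 _ _) (c^-1)%R => H i; lra.
    move: h1; move: (hellinger2 _ _) (c^-1)%R => H i; lra.
  rewrite esumD; last 2 first.
    move=> o _; rewrite mule_ge0 ?adde_ge0 ?lee_fin//.
    by rewrite addr_ge0// mulr_ge0// ltW.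
    by move=> o _; rewrite mule_ge0 ?lee_fin ?hellinger2_ge0// divr_ge0// ltW.
  rewrite !esumZ; last 4 first.
  - by rewrite divr_ge0// ltW.
  - by move=> o; rewrite lee_fin hellinger2_ge0.
  - by rewrite addr_ge0// mulr_ge0// ltW.
  - by move=> o; rewrite adde_ge0 ?lee_fin.
  have -> : \esum_(o in [set: T]) ((L true o)%:E + (L false o)%:E) =
      (2 * (1 - dl))%:E.
    rewrite mulr_natl mulr2n EFinD -{1}(LM true) -(LM false) -wsumDw//.
    by apply: eq_esum => o _; rewrite mule1 EFinD.
  apply: (@le_trans _ _ ((2^-1 + c^-1 / 2)%:E * (2 * (1 - dl))%:E + (c / 4)%:E * h%:E)).
    by rewrite leeD2l// lee_wpmul2l// lee_fin divr_ge0// ltW.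
  rewrite -!EFinM -EFinD lee_fin.
  have : (0 <= c^-1 * dl)%R by rewrite mulr_ge0// ltW.
  move: (c^-1)%R i0 => i i0; lra.
apply: (@le_trans _ _ ((2^-1)%:E * ((1 - dl + (c * h / 4 + c^-1))%:E + dl%:E * 1))).
  by rewrite lee_wpmul2l// leeD2r.
rewrite mule1 -EFinD -EFinM lee_fin; move: (c^-1)%R => i; lra.
Qed.

(** Partial recovery asks for its bound at all large depths, so it is refuted at a single large odd
    depth. *)
Lemma no_partial_recovery est : (block_factor a b < 1)%R -> root_estimator est ->
  ~ partial_recovery a b adversary est.
Proof.
move=> lt1 estP [eta eta2 [N _ HN]].
have bf0 := block_factor_ge0 a0 b0.
pose t := (eta - 2^-1)%R; have t0 : (0 < t)%R by rewrite subr_gt0.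
(* With this [c], [c^-1 / 2 = t / 4]; once the power of the block factor is below [t / c], the other
   error term is below [t / 4] too, and the advantage stays below [t]. *)
pose c := (2 / t)%R; have c0 : (0 < c)%R by rewrite divr_gt0.
have : (fun n => block_factor a b ^+ n)%R @ \oo --> (0 : R)%R.
  by apply: cvg_expr; rewrite ger0_norm.
move=> /cvgrPdist_lt /(_ (t / c)%R (divr_gt0 t0 c0))[M _ HM].
pose n := maxn N M.
have /= := HM n (leq_maxr N M).
rewrite sub0r normrN ger0_norm ?exprn_ge0// ltr_pdivlMr// => lt.
have [L [L0 LP Lh]] := live_law_contracting n 0.
have Nn : (N <= (n.*2 + 0).+1)%N.
  by rewrite addn0 -addnn ltnW// ltnS (leq_trans (leq_maxl N M))// leq_addr.
have := le_trans (HN _ Nn) (recovery_bound L0 LP estP c0 Lh).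
apply/negP; rewrite -ltNge lte_fin.
have -> : (c^-1 = t / 2)%R by rewrite /c invf_div.
have -> : eta = (2^-1 + t)%R by rewrite /t addrC subrK.
move: lt t0; move: (block_factor a b ^+ n)%R => z; lra.
Qed.
End Recovery.

(** * Choice of eps *)

Section Threshold.
Context {R : realType}.
Variable k : R.
Hypothesis k1 : 1 < k.

(** [block_factor] as a function of [eps]: [r] is [dead_rate], and [x] is the fraction of two-edge
    paths that thinning removes. *)
Definition threshold_factor (eps : R) : R :=
  let r := k * eps * expR (- k) in
  let x := eps ^+ 2 * (1 - expR (- r)) in
  (k * (1 - 2 * eps) ^+ 2) ^+ 2 * (1 - expR (r - k)) +
  expR (r - k) * (k ^+ 2 * (((1 - 2 * eps) ^+ 2 - x) ^+ 2 / (1 - x))).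

Lemma cut_fraction_lt1 (eps : R) : 0 <= eps <= 1 ->
  eps ^+ 2 * (1 - expR (- (k * eps * expR (- k)))) < 1.
Proof.
move=> /andP[e0 e1]; apply: (@le_lt_trans _ _ (1 - expR (- (k * eps * expR (- k))))).
  rewrite ler_piMl ?expr_le1// subr_ge0 -[leRHS]expR0 ler_expR oppr_le0.
  by rewrite !mulr_ge0 ?expR_ge0// ltW// (lt_trans ltr01).
by rewrite ltrBlDr ltrDl expR_gt0.
Qed.

Lemma block_factor_threshold (eps : R) : 0 < eps -> eps < 1 ->
  block_factor (2 * k * (1 - eps)) (2 * k * eps) = threshold_factor eps.
Proof.
move=> e0 e1.
have k0 : 0 < k := lt_trans ltr01 k1.
have := @cut_fraction_lt1 eps; rewrite (ltW e0) (ltW e1) => /(_ isT) x1.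
have aE : 2 * k * (1 - eps) / 2 = k * (1 - eps) by field.
have bE : 2 * k * eps / 2 = k * eps by field.
have abE : k * (1 - eps) + k * eps = k by ring.
rewrite /block_factor /edge_factor /path_factor /grandchild_mass /dead_rate aE bE abE.
rewrite /threshold_factor /=.
rewrite (_ : - (k - k * eps * expR (- k)) = k * eps * expR (- k) - k); last by ring.
set E := expR (_ - k); set c := expR (- (k * eps * expR (- k))) in x1 *.
congr (_ ^+ 2 * _ + E * _).
  by field; rewrite gt_eqF.
rewrite (_ : (k * (1 - eps)) ^+ 2 + c * (k * eps) ^+ 2 + 2 * (k * (1 - eps)) * (k * eps)
  = k ^+ 2 * (1 - eps ^+ 2 * (1 - c))); last by ring.
rewrite (_ : (k * (1 - eps)) ^+ 2 + c * (k * eps) ^+ 2 - 2 * (k * (1 - eps)) * (k * eps)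
  = k ^+ 2 * ((1 - 2 * eps) ^+ 2 - eps ^+ 2 * (1 - c))); last by ring.
have : 1 - eps ^+ 2 * (1 - c) != 0 by rewrite gt_eqF// subr_gt0.
move: (1 - eps ^+ 2 * (1 - c)) ((1 - 2 * eps) ^+ 2 - _) => y z y0.
by field; rewrite y0 gt_eqF.
Qed.

Definition critical_eps : R := (1 - Num.sqrt k^-1) / 2.

Lemma critical_eps_gt0 : 0 < critical_eps.
Proof.
have k0 : 0 < k := lt_trans ltr01 k1.
rewrite divr_gt0// subr_gt0 -[ltRHS]sqrtr1 ltr_sqrt// invf_lt1//.
Qed.

Lemma critical_eps_lt : critical_eps < 2^-1.
Proof.
have k0 : 0 < k := lt_trans ltr01 k1.
by rewrite ltr_pdivrMr// mulVf// ltrBlDr ltrDl sqrtr_gt0 invr_gt0.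
Qed.

Lemma critical_epsE : k * (1 - 2 * critical_eps) ^+ 2 = 1.
Proof.
have k0 : 0 < k := lt_trans ltr01 k1.
rewrite /critical_eps (_ : 1 - _ = Num.sqrt k^-1); last by field.
by rewrite sqr_sqrtr ?invr_ge0 ?ltW// divff// gt_eqF.
Qed.

(** Squares [expR (k / 2) >= 1 + k / 2]. It keeps [k^2 expR (- k)] below 8 for every [k], so that
    thinning does not overshoot. *)
Lemma sqr_lt_expR : k ^+ 2 < 8 * expR k.
Proof.
have k0 : 0 < k := lt_trans ltr01 k1.
have h : 1 + k / 2 <= expR (k / 2) := expR_ge1Dx _.
have : (1 + k / 2) ^+ 2 <= expR (k / 2) ^+ 2.
  by rewrite ler_sqr ?nnegrE ?expR_ge0// addr_ge0// divr_ge0// ltW.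
rewrite -expRM_natr (_ : k / 2 * 2%:R = k); last by field.
move: (expR k) => z; nra.
Qed.

(** The edge factor is 1 here, so the block factor is a weighted mean of 1 and the path factor
    [(1 - k x)^2 / (1 - x)]. The latter is below 1 because [1 - x - (1 - k x)^2 = x (2 k - 1 - k^2
    x)] and [k^2 x < k]. *)
Lemma threshold_factor_critical : threshold_factor critical_eps < 1.
Proof.
have k0 : 0 < k := lt_trans ltr01 k1.
have e0 := critical_eps_gt0; have e2 := critical_eps_lt; have eE := critical_epsE.
move: critical_eps e0 e2 eE => eps e0 e2 eE.
rewrite /threshold_factor/=.
set r := k * eps * expR (- k); set x := eps ^+ 2 * (1 - expR (- r)).
have D0 : 0 < expR (- k) := expR_gt0 _.
have r0 : 0 < r by rewrite !mulr_gt0.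
have x0 : 0 < x by rewrite mulr_gt0 ?exprn_gt0// subr_gt0 expR_lt1 oppr_lt0.
have x1 : x < 1.
  by apply: cut_fraction_lt1; rewrite ltW//=; move: e2; lra.
(* [k^2 x <= k eps^3 (k^2 expR (- k))], where [eps^3] is at most [1 / 8] and the last factor is
   below 8. *)
have kx : k ^+ 2 * x < k.
  have xr : x <= eps ^+ 2 * r.
    by rewrite ler_wpM2l ?sqr_ge0//; have := expR_ge1Dx (- r); lra.
  have kd : k ^+ 2 * expR (- k) < 8.
    by rewrite expRN ltr_pdivrMr ?expR_gt0// sqr_lt_expR.
  have e3 : eps ^+ 3 <= 8^-1.
    rewrite (_ : 8^-1 = (2^-1) ^+ 3); last by field.
    by apply: lerXn2r; rewrite ?nnegrE ?invr_ge0// ltW.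
  apply: (@le_lt_trans _ _ (k * (eps ^+ 3 * (k ^+ 2 * expR (- k))))).
    rewrite (_ : k * _ = k ^+ 2 * (eps ^+ 2 * r)); last by rewrite /r; ring.
    by rewrite ler_wpM2l ?sqr_ge0.
  rewrite gtr_pMr//; apply: (@le_lt_trans _ _ (8^-1 * (k ^+ 2 * expR (- k)))).
    by rewrite ler_wpM2r// mulr_ge0 ?sqr_ge0 ?ltW.
  by rewrite mulrC ltr_pdivrMr// mul1r.
set E := expR (r - k); have E0 : 0 < E by exact: expR_gt0.
rewrite eE expr1n mul1r.
suff : k ^+ 2 * (((1 - 2 * eps) ^+ 2 - x) ^+ 2 / (1 - x)) < 1.
  by move: E0; move: (k ^+ 2 * _) => z; nra.
rewrite mulrA ltr_pdivrMr ?subr_gt0// mul1r -exprMn mulrBr eE -subr_gt0.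
rewrite (_ : 1 - x - (1 - k * x) ^+ 2 = x * (2 * k - 1 - k ^+ 2 * x)); last by ring.
by rewrite mulr_gt0//; move: kx k1; lra.
Qed.

Lemma threshold_factor_cvg :
  threshold_factor e @[e --> critical_eps] --> threshold_factor critical_eps.
Proof.
have e0 := critical_eps_gt0; have e2 := critical_eps_lt.
have x1 : critical_eps ^+ 2 * (1 - expR (- (k * critical_eps * expR (- k)))) < 1.
  by apply: cut_fraction_lt1; rewrite ltW//=; move: e2; lra.
(* Closure rules for limits at [critical_eps]; their composition at the end mirrors the expression
   of [threshold_factor]. *)
pose to (f : R -> R) (z : R) := f e @[e --> critical_eps] --> z.
have cst (z : R) : to (fun=> z) z by exact: cvg_cst.
have id : to id critical_eps by exact: cvg_id.
have D f g y z : to f y -> to g z -> to (fun e => f e + g e) (y + z).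
  by move=> fy gz; exact: (cvgD fy gz).
have B f g y z : to f y -> to g z -> to (fun e => f e - g e) (y - z).
  by move=> fy gz; exact: (cvgB fy gz).
have M f g y z : to f y -> to g z -> to (fun e => f e * g e) (y * z).
  by move=> fy gz; exact: (cvgM fy gz).
have V f (z : R) : z != 0 -> to f z -> to (fun e => (f e)^-1) z^-1.
  by move=> z0 fz; exact: (cvgV z0 fz).
have X f z : to f z -> to (fun e => f e ^+ 2) (z ^+ 2).
  by move=> fz; exact: (M _ _ _ _ fz fz).
have E f z : to f z -> to (fun e => expR (f e)) (expR z).
  by move=> fz; exact: (cvg_comp _ _ fz (@continuous_expR R z)).
have N f z : to f z -> to (fun e => - f e) (- z).
  by move=> fz; exact: (cvgN fz).
have r := M _ _ _ _ (M _ _ _ _ (cst k) id) (cst (expR (- k))).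
have er := E _ _ (B _ _ _ _ r (cst k)).
have x := M _ _ _ _ (X _ _ id) (B _ _ _ _ (cst 1) (E _ _ (N _ _ r))).
have th := X _ _ (B _ _ _ _ (cst 1) (M _ _ _ _ (cst 2) id)).
have nz : 1 - critical_eps ^+ 2 *
  (1 - expR (- (k * critical_eps * expR (- k)))) != 0 by rewrite gt_eqF// subr_gt0.
exact (D _ _ _ _
  (M _ _ _ _ (X _ _ (M _ _ _ _ (cst k) th)) (B _ _ _ _ (cst 1) er))
  (M _ _ _ _ er (M _ _ _ _ (cst (k ^+ 2))
    (M _ _ _ _ (X _ _ (B _ _ _ _ th x)) (V _ _ nz (B _ _ _ _ (cst 1) x)))))).
Qed.

(** Slightly below [critical_eps] the recovery condition becomes strict, while the block factor is
    still below 1 by continuity. *)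
Lemma threshold_eps_exists : exists eps : R,
  [/\ 0 < eps, eps < 2^-1, 1 < k * (1 - 2 * eps) ^+ 2 & threshold_factor eps < 1].
Proof.
have k0 : 0 < k := lt_trans ltr01 k1.
have e2 := critical_eps_lt.
have h1 := nbhs_left_gt critical_eps_gt0.
have h2 := nbhs_left_lt critical_eps.
have h3 : \forall e \near critical_eps^'-, threshold_factor e < 1.
  exact: (cvgr_lt _ (cvg_at_left_filter threshold_factor_cvg) _
    threshold_factor_critical).
have [e [[e0 ec] e1]] := filter_ex (filterI (filterI h1 h2) h3).
exists e; split => //; first exact: lt_trans ec e2.
rewrite -[ltLHS]critical_epsE ltr_pM2l// ltr_sqr ?nnegrE; move: ec e2; lra.
Qed.

End Threshold.

Theorem theorem3 (R : realType) (k : R) (hk : 1 < k) :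
  exists eps : R,
    [/\ 0 < eps, eps < 2^-1, 1 < k * (1 - 2 * eps) ^+ 2 &
      exists2 adv : nat -> tree bool -> tree bool,
        cutting_adversary adv &
        forall est : nat -> tree (option bool) -> bool,
          root_estimator est ->
          ~ partial_recovery (2 * k * (1 - eps)) (2 * k * eps) adv est].
Proof.
have k0 : 0 < k := lt_trans ltr01 hk.
have [eps [e0 e2 ks f1]] := threshold_eps_exists hk.
have e1 : eps < 1 by move: e2; lra.
exists eps; split => //; exists adversary; first exact: adversary_cutting.
move=> est estP; apply: no_partial_recovery => //.
- by rewrite !mulr_gt0// subr_gt0.
- by rewrite !mulr_gt0.
- by rewrite block_factor_threshold.
Qed.
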